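(* Let $A\in\mathbb{R}^{2\times 2}$, $b,c\in\mathbb{R}^2$, $B=bc^T$, and let $\delta_{\min},\delta_{\max}$ be given continuous functions of $\kappa\in[0,1]$ with $-\infty<\delta_{\min}(\kappa)\le 0\le\delta_{\max}(\kappa)<\infty$. With $\mathbf{i}(\theta)=(\cos\theta,\sin\theta)^T$ and $\mathbf{j}(\theta)=(-\sin\theta,\cos\theta)^T$, put $$h(\kappa,\theta)=\mathbf{i}(\theta)^T(A+\kappa B)\mathbf{i}(\theta),\quad g(\kappa,\theta)=\mathbf{j}(\theta)^T(A+\kappa B)\mathbf{i}(\theta),\quad f(\kappa,\theta)=\frac{h(\kappa,\theta)}{g(\kappa,\theta)},$$ and assume $g(\kappa,\theta)>0$ for all $\kappa\in[0,1]$ and all $\theta$. Consider the control system $$r'=f(\kappa,\theta)\,r,\qquad \kappa'=g(\kappa,\theta)\,\nu(\kappa,\theta),\qquad \kappa(0)\in[0,1],\qquad \nu\in\mathcal{A},$$ and the variational problem on a fixed interval $[0,\bar\theta]$: given $\bar\kappa\in[0,1]$, find a control $\nu\in\mathcal{A}$ such that $$\frac{r(\bar\theta)}{r(0)}\to\max\quad\text{subject to }\kappa(\bar\theta)=\bar\kappa,$$ where the initial values $r(0)$ and $\kappa(0)$ are free. Then the equation $$\rho_\theta+g(\kappa,\theta)\min_{\nu\in\mathcal{A}}\{\nu(\kappa,\theta)\,\rho_\kappa\}=f(\kappa,\theta)\,\rho$$ is the Hamilton--Jacobi--Bellman equation for this variational problem. That is, the value function $$\rho(\bar\kappa,\bar\theta)=\max\frac{r(\bar\theta)}{r(0)}\quad\text{subject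 to }\kappa(\bar\theta)=\bar\kappa$$ is the viscosity solution of this equation on the half-strip $\kappa\in[0,1]$, $\theta\ge 0$ with the boundary condition $\rho(\kappa,0)=1$ for all $\kappa\in[0,1]$.
   Context: Prime denotes the derivative with respect to $\theta$, and $r\ge 0$. The set $\mathcal{A}$: it consists of the locally $L^1$-integrable functions $\nu$ satisfying $\delta_{\min}(\kappa)\le\nu\le\delta_{\max}(\kappa)$, with in addition $\nu\ge 0$ if $\kappa=0$ and $\nu\le 0$ if $\kappa=1$. Subscripts $\theta,\kappa$ on $\rho$ denote partial derivatives. No boundary condition is prescribed at $\kappa=0$ and $\kappa=1$. Viscosity solution is meant in the established sense of both a viscosity supersolution and a viscosity subsolution. Supersolution: for every smooth test function $\varphi$ with $\varphi=\rho$ at a point $(\kappa_0,\theta_0)$ and $\varphi\le\rho$ in a neighborhood of that point, the equation holds for $\varphi$ at $(\kappa_0,\theta_0)$ with ''$=$'' replaced by ''$\ge$''. Subsolution: for every smooth $\varphi$ with $\varphi=\rho$ at $(\kappa_0,\theta_0)$ and $\varphi\ge\rho$ in a neighborhood of that point, the equation holds for $\varphi$ at $(\kappa_0,\theta_0)$ with ''$=$'' replaced by ''$\le$''.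
   Formalization: The equation is asserted at interior points 0<κ<1, θ>0 only (with test functions at κ=0, κ=1 or θ=0 it fails), and ''the viscosity solution'' means ''a viscosity solution'': uniqueness, which fails as no condition is prescribed at κ=0,1, is not claimed. *)

(* Defs.v *)
(* A function of the pair (kappa, theta) takes kappa as its first argument, or
   as the first component of a point of [R * R]. *)
From HB Require Import structures.
From mathcomp Require Import all_boot all_order all_algebra.
From mathcomp Require Import all_classical all_reals all_analysis.

Set Implicit Arguments.
Unset Strict Implicit.
Unset Printing Implicit Defensive.

Import Order.TTheory GRing.Theory Num.Theory.
Import numFieldNormedType.Exports.

Local Open Scope classical_set_scope.
Local Open Scope ring_scope.

Definition ivec (R : realType) (t : R) : 'cV[R]_2 :=
  \col_k (if k == 0 then cos t else sin t).

Definition jvec (R : realType) (t : R) : 'cV[R]_2 :=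
  \col_k (if k == 0 then - sin t else cos t).

Definition hfun (R : realType) (A : 'M[R]_2) (b c : 'cV[R]_2) (k t : R) : R :=
  ((ivec t)^T *m (A + k *: (b *m c^T)) *m ivec t) 0 0.

Definition gfun (R : realType) (A : 'M[R]_2) (b c : 'cV[R]_2) (k t : R) : R :=
  ((jvec t)^T *m (A + k *: (b *m c^T)) *m ivec t) 0 0.

Definition fquot (R : realType) (A : 'M[R]_2) (b c : 'cV[R]_2) (k t : R) : R :=
  hfun A b c k t / gfun A b c k t.

(* The bounds are pointwise, not almost everywhere: the controls are evaluated
   along curves, and at single points in the Hamiltonian.  Every compact subset
   of the half-strip lies in some [0,1] x [0,T], hence the first clause is local
   integrability on the half-strip. *)
Definition controls (R : realType) (dmin dmax : R -> R) : set (R -> R -> R) :=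
  [set nu |
    (forall T : R, 0 <= T ->
       (@lebesgue_measure R \x @lebesgue_measure R)%E.-integrable
         (`[0, 1] `*` `[0, T]) (fun x : R * R => (nu x.1 x.2)%:E)) /\
    (forall k t : R, 0 <= k <= 1 -> 0 <= t ->
       [/\ dmin k <= nu k t, nu k t <= dmax k,
           k = 0 -> 0 <= nu k t & k = 1 -> nu k t <= 0])].

(* x' = F on [0,T] in the sense of Caratheodory: x is absolutely continuous
   with derivative F almost everywhere. *)
Definition caratheodory (R : realType) (T : R) (x F : R -> R) : Prop :=
  (@lebesgue_measure R).-integrable `[0, T] (EFin \o F) /\
  (forall t, 0 <= t <= T ->
     x t = x 0 + \int[@lebesgue_measure R]_(s in `[0, t]) F s).

(* [r 0] is positive so that the ratio [r T / r 0] makes sense; [k] stays in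
   [0,1], outside of which the controls carry no constraint. *)
Definition trajectory (R : realType) (g f nu : R -> R -> R) (T : R)
    (r k : R -> R) : Prop :=
  [/\ 0 < r 0,
      forall t, 0 <= t <= T -> 0 <= r t /\ 0 <= k t <= 1,
      caratheodory T r (fun s => f (k s) s * r s) &
      caratheodory T k (fun s => g (k s) s * nu (k s) s)].

Definition attainable (R : realType) (g f : R -> R -> R)
    (Adm : set (R -> R -> R)) (kbar tbar : R) : set R :=
  [set q | exists nu r k, [/\ Adm nu, trajectory g f nu tbar r k,
                              k tbar = kbar & q = r tbar / r 0]].

Definition value (R : realType) (g f : R -> R -> R)
    (Adm : set (R -> R -> R)) (kbar tbar : R) : R :=
  sup (attainable g f Adm kbar tbar).

Definition is_maximum (R : realType) (S : set R) (m : R) : Prop :=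
  S m /\ ubound S m.

(* Class C^n on the plane: differentiable with every directional derivative of
   class C^(n-1). *)
Fixpoint Cn (R : realType) (n : nat) (phi : R * R -> R) : Prop :=
  if n is m.+1 then
    (forall x, differentiable phi x) /\ (forall v, Cn m ('D_v phi))
  else continuous phi.

Definition smooth (R : realType) (phi : R * R -> R) : Prop :=
  forall n, Cn n phi.

(* rho_theta + g min_nu {nu(kappa,theta) rho_kappa} at the point (k, t).  For
   the controls above the set of values nu(k, t) is a compact interval, so the
   infimum is a minimum. *)
Definition hjb_lhs (R : realType) (g : R -> R -> R) (Adm : set (R -> R -> R))
    (phi : R * R -> R) (k t : R) : R :=
  'D_(0, 1) phi (k, t)
  + g k t * inf [set nu k t * 'D_(1, 0) phi (k, t) | nu in Adm].

(* The equation is tested where full neighbourhoods are available, at the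
   interior points of the half-strip; testing with one-sided neighbourhoods at
   kappa = 0, kappa = 1 or theta = 0 would admit test functions with an
   arbitrary normal slope there.  Continuity of [rho] is not required: with
   bounds that are merely continuous, the value function can be discontinuous. *)
Definition viscosity_supersolution (R : realType) (g f : R -> R -> R)
    (Adm : set (R -> R -> R)) (rho : R -> R -> R) : Prop :=
  forall (phi : R * R -> R) (k t : R), smooth phi ->
    0 < k < 1 -> 0 < t ->
    phi (k, t) = rho k t ->
    (\forall x \near (k, t), phi x <= rho x.1 x.2) ->
    hjb_lhs g Adm phi k t >= f k t * phi (k, t).

Definition viscosity_subsolution (R : realType) (g f : R -> R -> R)
    (Adm : set (R -> R -> R)) (rho : R -> R -> R) : Prop :=
  forall (phi : R * R -> R) (k t : R), smooth phi ->
    0 < k < 1 -> 0 < t ->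
    phi (k, t) = rho k t ->
    (\forall x \near (k, t), phi x >= rho x.1 x.2) ->
    hjb_lhs g Adm phi k t <= f k t * phi (k, t).

Definition viscosity_solution (R : realType) (g f : R -> R -> R)
    (Adm : set (R -> R -> R)) (rho : R -> R -> R) : Prop :=
  viscosity_supersolution g f Adm rho /\ viscosity_subsolution g f Adm rho.

(* Main.v *)
Require Import Defs.
From HB Require Import structures.
From mathcomp Require Import all_boot all_order all_algebra.
From mathcomp Require Import all_classical all_reals all_analysis.
From mathcomp Require Import measurable_realfun ring lra.
Import Order.TTheory GRing.Theory Num.Theory.
Import numFieldNormedType.Exports.
Local Open Scope classical_set_scope.
Local Open Scope ring_scope.

Set Implicit Arguments.
Unset Strict Implicit.

(** Along a trajectory, [r t / r 0] is the exponential of the integral of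
    [f (k s) s], so that only the component [k] matters.  A feedback control
    [nu x t] acts on a trajectory only through its values on the graph of [k].
    Hence the attainable curves [k] are those with values in [0, 1] that solve
    the differential inclusion [g * dmin <= k' <= g * dmax]: given such a curve,
    put [nu = k' / g] on its graph and [nu = 0] elsewhere.  This control
    satisfies the sign conditions at [k = 0] and [k = 1], since a curve confined
    to [0, 1] has zero derivative at almost every time it spends at 0 or 1.  This
    reduction is [attainable_curves].  The inclusion is expressed by increments
    ([inclusion_curve]); the density [k'] is recovered from the Radon-Nikodym and
    Lebesgue differentiation theorems ([lipschitz_ae_derivative]).

    The curves of the inclusion are equi-Lipschitz and the inclusion is stable
    under limits because the set of admissible slopes is an interval depending
    continuously on the point.  By compactness the integral of [f] attains its
    maximum ([path_integral_max_exists]), so the value function is a maximum.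

    The equation is the infinitesimal form of dynamic programming.  Write [rho]
    for the value.  If [k] is any curve, then
    [rho (k s) s * exp (int_s^t f) <= rho (k t) t], with equality when [k] is
    optimal for its endpoint at time [t].  Since the endpoint is prescribed at
    the final time, test functions are followed backwards along curves that
    arrive at the point of contact.  For a test function touching [rho] from
    below, every admissible slope can be used, through a straight line, and the
    inequality holds for all [nu], hence for the minimum
    ([supersolution_slope]).  For one touching from above, an optimal curve
    provides one [nu] for which the opposite inequality holds
    ([subsolution_slope]). *)

(** * Lipschitz functions and their densities *)

Lemma lipschitz_continuous (R : realType) (L : R) (f : R -> R) :
  (forall x y, x <= y -> `|f y - f x| <= L * (y - x)) -> continuous f.
Proof.
move=> fL; have fL' x y : `|f y - f x| <= `|L| * `|y - x|.
  have [xy|/ltW xy] := leP x y.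
    by rewrite (ger0_norm (_ : 0 <= y - x)) ?subr_ge0// (le_trans (fL _ _ xy))//
      ler_wpM2r ?subr_ge0 ?ler_norm.
  rewrite distrC (distrC y) (ger0_norm (_ : 0 <= x - y)) ?subr_ge0//.
  by rewrite (le_trans (fL _ _ xy))// ler_wpM2r ?subr_ge0 ?ler_norm.
move=> x; apply/cvgrPdist_lt => e e0; near=> y.
rewrite (le_lt_trans (fL' _ _))//.
have L1 : 0 < `|L| + 1 by rewrite ltr_wpDl.
apply: (@le_lt_trans _ _ ((`|L| + 1) * `|x - y|)).
  by rewrite ler_wpM2r// lerDl.
rewrite mulrC -ltr_pdivlMr//.
near: y; apply: cvgr_dist_lt; [exact: cvg_id|exact: divr_gt0].
Unshelve. all: by end_near. Qed.

Lemma continuous_integrable_segment (R : realType) (h : R -> R) (a b : R) :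
  continuous h -> (@lebesgue_measure R).-integrable `[a, b] (EFin \o h).
Proof.
move=> hc; apply: continuous_compact_integrable; first exact: segment_compact.
exact: continuous_subspaceT.
Qed.

Lemma cst_integrable_segment (R : realType) (a b c : R) :
  (@lebesgue_measure R).-integrable `[a, b] (EFin \o cst c).
Proof. by apply: continuous_integrable_segment => x; exact: cvg_cst. Qed.

Lemma lebesgue_stieltjes_measure_itvoc (R : realType) (f : cumulative R R)
    (a b : R) : a <= b ->
  lebesgue_stieltjes_measure f `]a, b]%classic = (f b - f a)%:E.
Proof.
move=> ab; rewrite /lebesgue_stieltjes_measure /measure_extension.
rewrite measurable_mu_extE/=; last exact: is_ocitv.
by rewrite wlength_itv_bnd.
Qed.

Lemma Rintegral_itv_cst (R : realType) (a b r : R) : a <= b ->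
  \int[@lebesgue_measure R]_(_ in `[a, b]) r = r * (b - a).
Proof.
move=> ab; rewrite Rintegral_cst//= lebesgue_measure_itv/= lte_fin.
by case: ltgtP ab => // -> _; rewrite subrr.
Qed.

(** For a Lipschitz constant [M], the functions [F x = (x + k x / M) / 2] and
    [H x = (x - k x / M) / 2] are nondecreasing and their sum is the identity, so
    their Lebesgue-Stieltjes measures add up to Lebesgue measure.  Therefore the
    measure of [F] is absolutely continuous, and its Radon-Nikodym derivative
    yields the density of [k]. *)
Lemma lipschitz_density (R : realType) (L T : R) (k : R -> R) : 0 <= T ->
  (forall x y, x <= y -> `|k y - k x| <= L * (y - x)) ->
  exists2 u : R -> R, (@lebesgue_measure R).-integrable setT (EFin \o u) &
    forall t, 0 <= t <= T ->
      k t = k 0 + \int[@lebesgue_measure R]_(s in `[0, t]) u s.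
Proof.
move=> T0 kL0.
(* A positive Lipschitz constant, to divide by. *)
pose M := Num.max L 1.
have M0 : 0 < M by rewrite /M lt_max ltr01 orbT.
have kL x y : x <= y -> `|k y - k x| <= M * (y - x).
  by move=> xy; rewrite (le_trans (kL0 _ _ xy))// ler_wpM2r ?subr_ge0// le_max lexx.
have kc := lipschitz_continuous kL.
pose F x := (x + k x / M) / 2.
pose H x := (x - k x / M) / 2.
have FD x y : F y - F x = ((y - x) + (k y - k x) / M) / 2.
  by rewrite /F; field; rewrite gt_eqF.
have HD x y : H y - H x = ((y - x) - (k y - k x) / M) / 2.
  by rewrite /H; field; rewrite gt_eqF.
have kM x y : x <= y -> `|(k y - k x) / M| <= y - x.
  move=> xy; rewrite normrM normfV (gtr0_norm M0) ler_pdivrMr// mulrC; exact: kL.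
have Fnd : {homo F : x y / x <= y}.
  move=> x y xy; rewrite -subr_ge0 FD divr_ge0//.
  by have := kM _ _ xy; rewrite ler_norml => /andP[]; lra.
have Hnd : {homo H : x y / x <= y}.
  move=> x y xy; rewrite -subr_ge0 HD divr_ge0//.
  by have := kM _ _ xy; rewrite ler_norml => /andP[]; lra.
have Fc : continuous F.
  move=> x; apply: cvgMr_tmp; apply: cvgD; first exact: cvg_id.
  by apply: cvgMr_tmp; exact: kc.
have Hc : continuous H.
  move=> x; apply: cvgMr_tmp; apply: cvgB; first exact: cvg_id.
  by apply: cvgMr_tmp; exact: kc.
pose Fm := isCumulative.Build R _ R F Fnd (right_continuousW Fc).
pose Hm := isCumulative.Build R _ R H Hnd (right_continuousW Hc).
pose Fcum : cumulative R R := HB.pack F Fm.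
pose Hcum : cumulative R R := HB.pack H Hm.
pose mF : {measure set (measurableTypeR R) -> \bar R} :=
  lebesgue_stieltjes_measure Fcum.
pose mH : {measure set (measurableTypeR R) -> \bar R} :=
  lebesgue_stieltjes_measure Hcum.
have mFoc a b : a <= b -> mF `]a, b]%classic = (F b - F a)%:E.
  exact: lebesgue_stieltjes_measure_itvoc.
have mHoc a b : a <= b -> mH `]a, b]%classic = (H b - H a)%:E.
  exact: lebesgue_stieltjes_measure_itvoc.
have sumE : forall A, measurable A -> lebesgue_measure A = measure_add mF mH A.
  apply: lebesgue_measure_unique => _ [[a b] _ <-].
  transitivity (mF `]a, b]%classic + mH `]a, b]%classic)%E; last first.
    by rewrite -measure_addE.
  have [ab|/ltW ba] := leP a b; last first.
    by rewrite set_itv_ge ?bnd_simp -?leNgt// !measure0 adde0.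
  rewrite mFoc// mHoc// lebesgue_measure_itv/= lte_fin.
  move: ab; rewrite le_eqVlt => /predU1P[->|ab].
    by rewrite ltxx !subrr adde0.
  rewrite ab -EFinB -EFinD FD HD; congr (_%:E).
  by field; rewrite ?gt_eqF.
(* The Radon-Nikodym theorem requires a finite measure. *)
have mT : measurable (`]0, T]%classic : set (measurableTypeR R)) by [].
have mTfin : (mF `]0%R, T]%classic < +oo)%E by rewrite mFoc// ltry.
pose nu : {finite_measure set (measurableTypeR R) -> \bar R} := mfrestr mT mTfin.
have dom : nu `<< (@lebesgue_measure R).
  move=> N N0 A mA AN.
  have : lebesgue_measure A = 0%E by exact: N0.
  rewrite sumE// measure_addE => /eqP.
  rewrite padde_eq0// => /andP[/eqP mFA _].
  apply/eqP; rewrite eq_le measure_ge0 andbT -mFA.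
  by rewrite /nu/= /mfrestr /mrestr le_measure// ?inE//; exact: measurableI.
pose c := charge_of_finite_measure nu.
have cdom : c `<< (@lebesgue_measure R) by [].
pose v := Radon_Nikodym c (@lebesgue_measure R).
have vfin x : v x \is a fin_num by exact: Radon_Nikodym_fin_num.
pose w x := M * (2 * fine (v x) - 1).
have vint : (@lebesgue_measure R).-integrable setT v.
  exact: Radon_Nikodym_integrable.
have fvint D : measurable D ->
    (@lebesgue_measure R).-integrable D (fun x => (fine (v x))%:E).
  move=> mD; apply: (@eq_integrable _ _ _ _ _ mD v).
    by move=> x _; rewrite fineK.
  exact: integrableS vint.
have w1int a b : (@lebesgue_measure R).-integrable `[a, b]
    (EFin \o (fun x => 2 * fine (v x))).
  apply: (@eq_integrable _ _ _ _ _ _ (fun x => 2%:E * (fine (v x))%:E)%E) => //.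
  by apply: integrableZl => //; exact: fvint.
have w2int a b : (@lebesgue_measure R).-integrable `[a, b]
    (EFin \o (fun x => 2 * fine (v x) - 1)).
  have h := integrableB _ (w1int a b) (cst_integrable_segment a b 1).
  exact: h (measurable_itv _).
have wint a b : (@lebesgue_measure R).-integrable `[a, b] (EFin \o w).
  have h := integrableZl _ M (w2int a b).
  exact: h (measurable_itv _).
exists (w \_ `[0, T]).
  rewrite -restrict_EFin; apply/integrable_restrict => //=; rewrite setTI.
  exact: wint.
move=> t /andP[t0 tT].
have -> : \int[lebesgue_measure]_(s in `[0, t]) (w \_ `[0, T]) s =
    \int[lebesgue_measure]_(s in `[0, t]) w s.
  apply: eq_Rintegral => x; rewrite inE/= in_itv/= => /andP[x0 xt].
  by rewrite patchE mem_set//= in_itv/= x0 (le_trans xt).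
have vE : F t - F 0 = \int[lebesgue_measure]_(s in `[0, t]) fine (v s).
  rewrite -Rintegral_itv_obnd_cbnd; last exact: fvint.
  have := @Radon_Nikodym_integral _ _ _ c (@lebesgue_measure R) `]0, t]%classic cdom.
  move=> /(_ (measurable_itv _)).
  rewrite /= /mfrestr /mrestr setIidl; last first.
    by apply: subset_itvl; rewrite bnd_simp.
  rewrite mFoc// /Rintegral => /(congr1 fine) /= ->; congr fine.
  by apply: eq_integral => x _; rewrite fineK.
rewrite /w RintegralZl// RintegralB//; last exact: cst_integrable_segment.
rewrite RintegralZl//; last exact: fvint.
rewrite -vE Rintegral_itv_cst// subr0 mul1r.
by rewrite FD; field; rewrite ?gt_eqF.
Qed.

(** Lebesgue differentiation applied to the density. *)
Lemma lipschitz_ae_derivative (R : realType) (L T : R) (k : R -> R) : 0 <= T ->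
  (forall x y, x <= y -> `|k y - k x| <= L * (y - x)) ->
  exists u : R -> R, [/\ (@lebesgue_measure R).-integrable setT (EFin \o u),
    forall t, 0 <= t <= T -> k t = k 0 + \int[@lebesgue_measure R]_(s in `[0, t]) u s &
    {ae @lebesgue_measure R, forall x, 0 < x < T ->
      (fun h => h^-1 * (k (h + x) - k x)) @ 0^' --> u x}].
Proof.
move=> T0 kL; have [u uint ku] := lipschitz_density T0 kL.
exists u; split => //.
have uloc := open_integrable_locally openT uint.
have uint0 y : (@lebesgue_measure R).-integrable
    [set` Interval (BLeft 0) (BRight y)] (EFin \o u).
  exact: integrableS uint.
apply: (@filterS _ _ (ae_filter_ringOfSetsType (@lebesgue_measure R)) _ _ _
  (FTC1 uint0 uloc)) => x /= + /andP[x0 xT].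
move=> /(_ _)[]; first by rewrite lte_fin.
set U := (X in derivable X) => dU U'.
have nearU : {near x, U =1 (fun y => k y - k 0)}.
  have xin : x \in `]0, T[ by rewrite in_itv/= x0.
  apply: filterS (near_in_itvoo xin) => y; rewrite in_itv/= => /andP[y0 yT].
  by rewrite ku ?(ltW y0) ?(ltW yT)// addrC addKr.
have dk : derivable (fun y => k y - k 0) x 1 by exact: near_eq_derivable nearU dU.
have k' : 'D_1 (fun y => k y - k 0) x = u x.
  by rewrite -(near_eq_derive _ nearU) -derive1E.
move: dk => /cvg_ex[l]; rewrite -k' /derive => h; move: (h) => /cvg_lim -> //.
apply: cvg_trans h; apply: near_eq_cvg; near=> y.
by rewrite /= /GRing.scale/= mulr1 opprB addrA subrK.
Unshelve. all: by end_near. Qed.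

(** Difference quotients on the two sides of a minimum have opposite signs.
    This is what makes the controls vanish when a curve touches the boundary of
    [0, 1]. *)
Lemma derivative_at_min (R : realType) (k : R -> R) (x u : R) :
  (forall y, k x <= k y) ->
  (fun h => h^-1 * (k (h + x) - k x)) @ 0^' --> u -> u = 0.
Proof.
move=> kmin ku; apply/le_anti/andP; split.
  have kul := cvg_dnbhs_at_left ku.
  apply: (cvgr_to_le kul); near=> h.
  have h0 : h < 0 by near: h; exact: nbhs_left_lt.
  by rewrite mulr_le0_ge0// ?subr_ge0// invr_le0 ltW.
have kur := cvg_dnbhs_at_right ku.
apply: (cvgr_to_ge kur); near=> h.
have h0 : 0 < h by near: h; exact: nbhs_right_gt.
by rewrite mulr_ge0// ?subr_ge0// invr_ge0 ltW.
Unshelve. all: by end_near. Qed.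

Lemma derivative_at_max (R : realType) (k : R -> R) (x u : R) :
  (forall y, k y <= k x) ->
  (fun h => h^-1 * (k (h + x) - k x)) @ 0^' --> u -> u = 0.
Proof.
move=> kmax ku; apply: oppr_inj; rewrite oppr0.
apply: (@derivative_at_min _ (fun y => - k y) x) => [y|]; first by rewrite lerN2.
suff -> : (fun h => h^-1 * (- k (h + x) - - k x)) =
    - (fun h => h^-1 * (k (h + x) - k x)) by exact: cvgN.
by apply/funext => h; rewrite fctE; ring.
Qed.

(** * Clamping to a segment *)

(** Composing with [clamp a b] extends a function on [a, b] to a function on
    the line that is continuous, or Lipschitz, when the original is. *)
Definition clamp (R : realType) (a b x : R) : R := Num.max a (Num.min b x).

Lemma clamp_id (R : realType) (a b x : R) : a <= x <= b -> clamp a b x = x.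
Proof. by rewrite /clamp => /andP[ax xb]; rewrite min_r// max_r. Qed.

Lemma clamp_bounds (R : realType) (a b x : R) : a <= b -> a <= clamp a b x <= b.
Proof. by move=> ab; rewrite /clamp le_max lexx/= ge_max ab ge_min lexx. Qed.

Lemma clamp_lipschitz (R : realType) (a b x y : R) : a <= b -> x <= y ->
  0 <= clamp a b y - clamp a b x <= y - x.
Proof.
move=> ab xy; rewrite /clamp.
by case: (leP b x) => bx; case: (leP b y) => yb;
  repeat (match goal with |- context [Num.max ?u ?v] => case: (leP u v) => ? end);
  apply/andP; split; lra.
Qed.

Lemma clamp_continuous (R : realType) (a b : R) : a <= b -> continuous (clamp a b).
Proof.
move=> ab; apply: (@lipschitz_continuous _ 1) => x y xy; rewrite mul1r.
by have /andP[h1 h2] := clamp_lipschitz ab xy; rewrite ger0_norm.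
Qed.

Lemma clamp_within_continuous (R : realType) (f : R -> R) (a b : R) : a <= b ->
  {within `[a, b], continuous f} -> continuous (f \o clamp a b).
Proof.
move=> ab /subspace_continuousP fc x.
have cx : `[a, b]%classic (clamp a b x) by rewrite /= in_itv/= clamp_bounds.
refine (@cvg_comp _ _ _ (clamp a b) f _ _ _ _ (fc _ cx)).
move=> A /(clamp_continuous ab (x := x)) hA.
have h : \forall y \near x, `[a, b]%classic (clamp a b y) -> A (clamp a b y) := hA.
suff : \forall y \near x, A (clamp a b y) by [].
apply: filterS h => y; apply; rewrite /= in_itv/=; exact: clamp_bounds.
Qed.

(** * Curves of a differential inclusion *)

(** An integrated form of [lo (k s) s <= k' s <= hi (k s) s], free of
    derivatives: every increment is bounded by any constant that bounds the
    slope along the way.  Unlike the almost everywhere condition, it passes to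
    uniform limits at once and is stable under concatenation; the density of
    [k] is only recovered in the end. *)
Definition inclusion_curve (R : realType) (lo hi : R -> R -> R) (a b : R)
    (k : R -> R) : Prop :=
  (forall s, a <= s <= b -> 0 <= k s <= 1) /\
  (forall s1 s2 M, a <= s1 -> s1 <= s2 -> s2 <= b ->
    ((forall s, s1 <= s <= s2 -> hi (k s) s <= M) ->
       k s2 - k s1 <= M * (s2 - s1)) /\
    ((forall s, s1 <= s <= s2 -> M <= lo (k s) s) ->
       M * (s2 - s1) <= k s2 - k s1)).

Lemma bounded_on_box (R : realType) (G : R -> R -> R) (a b c d : R) :
  continuous (fun p : R * R => G p.1 p.2) ->
  exists2 L, 0 < L & forall x y, a <= x <= b -> c <= y <= d -> `|G x y| <= L.
Proof.
move=> Gc.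
have cbox : compact (`[a, b]%classic `*` `[c, d]%classic : set (R * R)).
  by apply: compact_setX; exact: segment_compact.
have : compact ((fun p : R * R => G p.1 p.2) @` (`[a, b] `*` `[c, d])%classic).
  by apply: continuous_compact cbox; exact: continuous_subspaceT.
move=> /compact_bounded[M [_ MG]].
exists (Num.max 1 (M + 1)) => [|x y xab ycd]; first by rewrite lt_max ltr01.
apply: (MG (Num.max 1 (M + 1))); first by rewrite lt_max ltrDl ltr01 orbT.
by exists (x, y) => //; split; rewrite /= in_itv.
Qed.

Section curves.
Context (R : realType) (lo hi : R -> R -> R).
Hypothesis lo_cont : continuous (fun p : R * R => lo p.1 p.2).
Hypothesis hi_cont : continuous (fun p : R * R => hi p.1 p.2).
Hypothesis lo_le0 : forall x s, lo x s <= 0.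
Hypothesis hi_ge0 : forall x s, 0 <= hi x s.

Lemma inclusion_curve_sub a b a' b' k : a <= a' -> b' <= b ->
  inclusion_curve lo hi a b k -> inclusion_curve lo hi a' b' k.
Proof.
move=> aa bb [k01 kM]; split => [s /andP[? ?]|s1 s2 M ? ? ?].
  by apply: k01; lra.
by apply: kM => //; lra.
Qed.

Lemma eq_inclusion_curve a b k k' : (forall s, a <= s <= b -> k s = k' s) ->
  inclusion_curve lo hi a b k -> inclusion_curve lo hi a b k'.
Proof.
move=> kk' [k01 kM]; split => [s sab|s1 s2 M as1 s12 s2b].
  by rewrite -kk'//; exact: k01.
have [h1 h2] := kM s1 s2 M as1 s12 s2b.
rewrite -!kk'; try by apply/andP; split; lra.
by split => h; [apply: h1|apply: h2] => s /andP[? ?]; rewrite kk' ?h//; lra.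
Qed.

Lemma inclusion_curve_cat a m b k : a <= m -> m <= b ->
  inclusion_curve lo hi a m k -> inclusion_curve lo hi m b k ->
  inclusion_curve lo hi a b k.
Proof.
move=> am mb [k01 kM] [k01' kM']; split.
  move=> s /andP[? ?]; have [sm|ms] := leP s m; first by apply: k01; lra.
  by apply: k01'; lra.
move=> s1 s2 M as1 s12 s2b.
have [s2m|ms2] := leP s2 m; first exact: kM.
have [ms1|s1m] := leP m s1; first exact: kM'.
have [h1 h2] := kM s1 m M as1 (ltW s1m) (lexx _).
have [h3 h4] := kM' m s2 M (lexx _) (ltW ms2) s2b.
split=> h.
  have : k m - k s1 <= M * (m - s1) by apply: h1 => s ?; apply: h; lra.
  have : k s2 - k m <= M * (s2 - m) by apply: h3 => s ?; apply: h; lra.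
  by lra.
have : M * (m - s1) <= k m - k s1 by apply: h2 => s ?; apply: h; lra.
have : M * (s2 - m) <= k s2 - k m by apply: h4 => s ?; apply: h; lra.
by lra.
Qed.

Lemma inclusion_curve_line a b x w :
  (forall s, a <= s <= b -> 0 <= x + w * (s - b) <= 1) ->
  (forall s, a <= s <= b -> lo (x + w * (s - b)) s <= w <= hi (x + w * (s - b)) s) ->
  inclusion_curve lo hi a b (fun s => x + w * (s - b)).
Proof.
move=> h01 hw; split => // s1 s2 M as1 s12 s2b.
have -> : x + w * (s2 - b) - (x + w * (s1 - b)) = w * (s2 - s1) by ring.
have /andP[h1 h2] : lo (x + w * (s1 - b)) s1 <= w <= hi (x + w * (s1 - b)) s1.
  by apply: hw; lra.
by split=> /(_ s1); rewrite lexx s12 => /(_ erefl) h;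
  rewrite ler_wpM2r ?subr_ge0//; lra.
Qed.

Lemma inclusion_curve_cst a b x : 0 <= x <= 1 ->
  inclusion_curve lo hi a b (fun=> x).
Proof.
move=> x01; apply: eq_inclusion_curve (@inclusion_curve_line a b x 0 _ _).
- by move=> s _; rewrite mul0r addr0.
- by move=> s _; rewrite mul0r addr0.
- by move=> s _; rewrite mul0r addr0 lo_le0 hi_ge0.
Qed.

(** The constant does not depend on the curve: this equicontinuity is the source
    of compactness. *)
Lemma inclusion_curve_lipschitz a b : exists2 L, 0 < L &
  forall k, inclusion_curve lo hi a b k ->
  forall s1 s2, a <= s1 -> s1 <= s2 -> s2 <= b -> `|k s2 - k s1| <= L * (s2 - s1).
Proof.
have [L1 L1p hL1] := @bounded_on_box R lo 0 1 a b lo_cont.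
have [L2 L2p hL2] := @bounded_on_box R hi 0 1 a b hi_cont.
exists (L1 + L2); first exact: addr_gt0.
move=> k [k01 kM] s1 s2 as1 s12 s2b.
have [h1 _] := kM s1 s2 L2 as1 s12 s2b.
have [_ h2] := kM s1 s2 (- L1) as1 s12 s2b.
have in_box s : s1 <= s <= s2 -> 0 <= k s <= 1 /\ a <= s <= b.
  by move=> /andP[? ?]; split; [apply: k01|]; lra.
have {}h1 : k s2 - k s1 <= L2 * (s2 - s1).
  apply: h1 => s /in_box[k01s sab]; have := hL2 _ _ k01s sab.
  by rewrite ler_norml; lra.
have {}h2 : - L1 * (s2 - s1) <= k s2 - k s1.
  apply: h2 => s /in_box[k01s sab]; have := hL1 _ _ k01s sab.
  by rewrite ler_norml; lra.
have L1s : 0 <= L1 * (s2 - s1) by rewrite mulr_ge0 ?subr_ge0// ltW.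
have L2s : 0 <= L2 * (s2 - s1) by rewrite mulr_ge0 ?subr_ge0// ltW.
rewrite ler_norml; apply/andP; split; lra.
Qed.

End curves.

(** * Compactness and existence of an optimal curve *)

(** Continuous convergence: [k' s'] tends to [k s] as [k'] runs along [G] and
    [s'] tends to [s], jointly.  For equi-Lipschitz families it follows from
    pointwise convergence, and it is preserved by composition with a continuous
    function, so it replaces uniform convergence on compact sets. *)
Definition continuously_cvg (R : realType) (G : set_system (R -> R))
    (k : R -> R) : Prop :=
  forall s, (fun p : R * (R -> R) => p.2 p.1) @ filter_prod (nbhs s) G --> k s.

Lemma continuously_cvg_pointwise (R : realType) (G : set_system (R -> R))
    (k : R -> R) : Filter G -> continuously_cvg G k ->
  forall s, (fun k' : R -> R => k' s) @ G --> k s.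
Proof.
move=> FG Gk s; apply/cvgrPdist_lt => e e0.
have [[A B] [/= As GB] AB] : filter_prod (nbhs s) G
    [set p | `|k s - p.2 p.1| < e] by move/cvgrPdist_lt : (Gk s); apply.
apply: filterS GB => k' Bk'; apply: (AB (s, k')); split => //.
exact: nbhs_singleton.
Qed.

(** A cluster point in the topology of pointwise convergence exists by
    Tychonoff's theorem; the common Lipschitz constant upgrades the convergence.
    A filter finer than [Fil] plays the role of a convergent subsequence. *)
Lemma lipschitz_family_cluster (R : realType) (L : R) (Fil : set_system (R -> R)) :
  ProperFilter Fil -> 0 < L ->
  Fil [set k | (forall x y, x <= y -> `|k y - k x| <= L * (y - x)) /\
               (forall x, 0 <= k x <= 1)] ->
  exists G (k : R -> R), [/\ ProperFilter G, Fil `<=` G,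
    (forall x y, x <= y -> `|k y - k x| <= L * (y - x)),
    (forall x, 0 <= k x <= 1) &
    continuously_cvg G k].
Proof.
move=> PF L0 FilL.
have cK := @tychonoff R (fun=> R) (fun=> `[0, 1]%classic)
  (fun=> @segment_compact R 0 1).
have [k [k01]] : [set k | forall x : R, (`[0, 1]%classic : set R) (k x)] `&`
    cluster (Fil : set_system {ptws R -> R}) !=set0.
  by apply: cK; apply: filterS FilL => k [_ k01] x; rewrite /= in_itv; exact: k01.
rewrite cluster_cvgE => -[G PG [Gk FilG]].
have {}k01 x : 0 <= k x <= 1 by have := k01 x; rewrite /= in_itv.
have Gks s : (fun g => g s) @ G --> k s.
  exact: (@pointwise_cvgP R R G k _).1 Gk s.
have GL := FilG _ FilL.
have GL1 x y : x <= y -> \forall g \near G, `|g y - g x| <= L * (y - x).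
  by move=> xy; apply: filterS GL => g [+ _]; apply.
exists G, k; split => //.
  move=> x y xy; apply: (@cvgr_to_le _ G _ _ (fun g => `|g y - g x|)).
    by apply: cvg_norm; apply: cvgB; exact: Gks.
  exact: GL1.
move=> s; apply/cvgrPdist_lt => e e0.
have e2 : 0 < e / 2 by rewrite divr_gt0.
have near_s : \forall s' \near s, L * `|s' - s| < e / 2.
  near=> s'; rewrite mulrC -ltr_pdivlMr// distrC.
  by near: s'; apply: cvgr_dist_lt; [exact: cvg_id|rewrite divr_gt0].
have near_g : \forall g \near G, `|k s - g s| < e / 2 /\
    (forall x y, x <= y -> `|g y - g x| <= L * (y - x)).
  apply: filterI; first by have /cvgrPdist_lt := Gks s; apply.
  by apply: filterS GL => g [].
exists ([set s' | L * `|s' - s| < e / 2],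
        [set g : R -> R | `|k s - g s| < e / 2 /\
          (forall x y, x <= y -> `|g y - g x| <= L * (y - x))]); first by split.
move=> [s' g] [/= s's [gs gL]].
have gss' : `|g s' - g s| <= L * `|s' - s|.
  have [ss'|/ltW ss'] := leP s s'.
    by rewrite (ger0_norm (_ : 0 <= s' - s)) ?subr_ge0//; exact: gL.
  rewrite distrC (distrC s') (ger0_norm (_ : 0 <= s - s')) ?subr_ge0//.
  exact: gL.
rewrite (splitr e) (_ : k s - g s' = (k s - g s) - (g s' - g s)); last by ring.
rewrite (le_lt_trans (ler_normB _ _))// ltrD//.
exact: le_lt_trans gss' s's.
Unshelve. all: by end_near. Qed.

Definition path_integral (R : realType) (F : R -> R -> R) (a b : R)
    (k : R -> R) : R :=
  \int[@lebesgue_measure R]_(s in `[a, b]) F (k s) s.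

Lemma continuous_along (R : realType) (F : R -> R -> R) (k : R -> R) :
  continuous (fun p : R * R => F p.1 p.2) -> continuous k ->
  continuous (fun s => F (k s) s).
Proof.
move=> Fc kc s.
exact: (cvg_comp2 (kc s) cvg_id (Fc (k s, s))).
Qed.

(** Continuous convergence is uniform on compact segments, by the near-covering
    form of compactness. *)
Lemma near_uniform_along (R : realType) (F : R -> R -> R) (a b e : R)
    (G : set_system (R -> R)) (k : R -> R) : ProperFilter G ->
  continuous (fun p : R * R => F p.1 p.2) -> continuous k ->
  continuously_cvg G k ->
  0 < e ->
  \forall k' \near G, forall s, a <= s <= b -> `|F (k' s) s - F (k s) s| <= e.
Proof.
move=> PG Fc kc Gk e0.
have cab := (compact_near_coveringP _).1 (@segment_compact R a b).
apply: filterS (cab _ G (fun k' s => `|F (k' s) s - F (k s) s| <= e) _ _).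
  by move=> k' h s sab; apply: h; rewrite /= in_itv.
move=> s _.
have FG : (fun p : R * (R -> R) => F (p.2 p.1) p.1) @ filter_prod (nbhs s) G
    --> F (k s) s.
  exact: (cvg_comp2 (Gk s) cvg_fst (Fc (k s, s))).
have e2 : 0 < e / 2 by rewrite divr_gt0.
have [[A B] [/= As GB] AB] : filter_prod (nbhs s) G
    [set p | `|F (k s) s - F (p.2 p.1) p.1| < e / 2].
  by move/cvgrPdist_lt : FG; apply.
have Cs : nbhs s [set s' | `|F (k s) s - F (k s') s'| < e / 2].
  by move/cvgrPdist_lt : (continuous_along Fc kc (x := s)); apply.
exists (A `&` [set s' | `|F (k s) s - F (k s') s'| < e / 2], B) => /=.
  by split => //; exact: filterI.
move=> [s' k'] [/= [As' Cs'] Bk'].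
have h1 : `|F (k s) s - F (k' s') s'| < e / 2 by exact: (AB (s', k')).
rewrite (_ : _ - _ = (F (k s) s - F (k s') s') - (F (k s) s - F (k' s') s'));
  last by ring.
by rewrite (le_trans (ler_normB _ _))// (splitr e) lerD// ltW.
Qed.

Section existence.
Context (R : realType) (lo hi F : R -> R -> R).
Hypothesis lo_cont : continuous (fun p : R * R => lo p.1 p.2).
Hypothesis hi_cont : continuous (fun p : R * R => hi p.1 p.2).
Hypothesis F_cont : continuous (fun p : R * R => F p.1 p.2).
Hypothesis lo_le0 : forall x s, lo x s <= 0.
Hypothesis hi_ge0 : forall x s, 0 <= hi x s.

Lemma inclusion_curve_clamp a b : a <= b ->
  exists2 L, 0 < L & forall k, inclusion_curve lo hi a b k ->
  (forall x y, x <= y -> `|k (clamp a b y) - k (clamp a b x)| <= L * (y - x)) /\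
  (forall x, 0 <= k (clamp a b x) <= 1).
Proof.
move=> ab; have [L L0 hL] := @inclusion_curve_lipschitz R lo hi lo_cont hi_cont a b.
exists L => // k kadm; split => [x y xy|x]; last first.
  by apply: kadm.1; exact: clamp_bounds.
have /andP[xa xb] := clamp_bounds x ab.
have /andP[ya yb] := clamp_bounds y ab.
have /andP[c1 c2] := clamp_lipschitz ab xy.
apply: (le_trans (hL k kadm _ _ _ _ _)) => //; first by rewrite -subr_ge0.
by rewrite ler_wpM2l// ltW.
Qed.

Lemma inclusion_curve_integrable a b k : a <= b -> inclusion_curve lo hi a b k ->
  (@lebesgue_measure R).-integrable `[a, b] (EFin \o (fun s => F (k s) s)).
Proof.
move=> ab kadm; have [L L0 /(_ k kadm)[kL _]] := inclusion_curve_clamp ab.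
have : (@lebesgue_measure R).-integrable `[a, b]
    (EFin \o (fun s => F (k (clamp a b s)) s)).
  apply/continuous_integrable_segment/(continuous_along F_cont).
  exact: lipschitz_continuous kL.
apply: eq_integrable => // s; rewrite inE/= in_itv/= => sab.
by rewrite clamp_id.
Qed.

Lemma le_path_integral a b k k' e : a <= b ->
  inclusion_curve lo hi a b k -> inclusion_curve lo hi a b k' ->
  (forall s, a <= s <= b -> F (k' s) s <= F (k s) s + e) ->
  path_integral F a b k' <= path_integral F a b k + e * (b - a).
Proof.
move=> ab kadm k'adm h.
have cint := cst_integrable_segment a b e.
have kint := inclusion_curve_integrable ab kadm.
rewrite /path_integral -(Rintegral_itv_cst e ab) -RintegralD//.
apply: le_Rintegral => //; first exact: inclusion_curve_integrable.
have hh := integrableD _ kint cint.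
exact: hh (measurable_itv _).
Qed.

(** If [M] bounds [hi] along the limit curve, then [M + e / (s2 - s1)] bounds it
    along the nearby curves, whose increments then pass to the limit. *)
Lemma inclusion_curve_limit (a b : R) (G : set_system (R -> R)) (k : R -> R) :
  ProperFilter G -> continuous k -> (forall s, 0 <= k s <= 1) ->
  continuously_cvg G k -> G (inclusion_curve lo hi a b) ->
  inclusion_curve lo hi a b k.
Proof.
move=> PG kc k01 Gk Gadm; have Gpt := continuously_cvg_pointwise _ Gk.
split => // s1 s2 M as1 s12 s2b.
have [<-|s1n2] := eqVneq s1 s2; first by rewrite !subrr mulr0.
have s0 : 0 < s2 - s1 by rewrite subr_gt0 lt_neqAle s1n2.
split=> h; apply/ler_addgt0Pr => e e0; have es0 := divr_gt0 e0 s0.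
  have Ghi := near_uniform_along a b PG hi_cont kc Gk es0.
  apply: (@cvgr_to_le _ G _ _ (fun k' => k' s2 - k' s1)).
    by apply: cvgB; exact: Gpt.
  near=> k'.
  have k'adm : inclusion_curve lo hi a b k' by near: k'.
  have k'hi : forall s, a <= s <= b ->
    `|hi (k' s) s - hi (k s) s| <= e / (s2 - s1) by near: k'.
  have [+ _] := k'adm.2 s1 s2 (M + e / (s2 - s1)) as1 s12 s2b.
  rewrite mulrDl divfK ?gt_eqF//; apply => s /[dup] /h hM /andP[s1s ss2].
  have /k'hi : a <= s <= b by rewrite (le_trans as1)// (le_trans ss2).
  by rewrite ler_norml => /andP[_]; lra.
have Glo := near_uniform_along a b PG lo_cont kc Gk es0.
rewrite -lerBlDr; apply: (@cvgr_to_ge _ G _ _ (fun k' => k' s2 - k' s1)).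
  by apply: cvgB; exact: Gpt.
near=> k'.
have k'adm : inclusion_curve lo hi a b k' by near: k'.
have k'lo : forall s, a <= s <= b ->
  `|lo (k' s) s - lo (k s) s| <= e / (s2 - s1) by near: k'.
have [_] := k'adm.2 s1 s2 (M - e / (s2 - s1)) as1 s12 s2b.
rewrite mulrBl divfK ?gt_eqF//; apply => s /[dup] /h hM /andP[s1s ss2].
have /k'lo : a <= s <= b by rewrite (le_trans as1)// (le_trans ss2).
by rewrite ler_norml => /andP[+ _]; lra.
Unshelve. all: by end_near. Qed.

(** A maximizing sequence of curves has a limit which is again a curve, and the
    integral is continuous for the convergence at hand. *)
Lemma path_integral_max_exists b x : 0 <= b -> 0 <= x <= 1 ->
  exists k, [/\ inclusion_curve lo hi 0 b k, k b = x &
    forall k', inclusion_curve lo hi 0 b k' -> k' b = x ->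
      path_integral F 0 b k' <= path_integral F 0 b k].
Proof.
move=> b0 x01.
pose S := [set path_integral F 0 b k | k in
  [set k | inclusion_curve lo hi 0 b k /\ k b = x]].
have cst_adm : inclusion_curve lo hi 0 b (fun=> x).
  exact: inclusion_curve_cst.
have [M M0 hM] := @bounded_on_box R F 0 1 0 b F_cont.
have Sne : S !=set0 by exists (path_integral F 0 b (fun=> x)); exists (fun=> x).
have Sub : has_ubound S.
  exists (path_integral F 0 b (fun=> x) + (M + M) * b) => _ [k [kadm kb] <-].
  rewrite -[X in _ * X]subr0; apply: le_path_integral => // s sb.
  have := hM _ _ (kadm.1 _ sb) sb; have := hM _ _ x01 sb.
  by rewrite !ler_norml => /andP[? ?] /andP[? ?]; lra.
have [L L0 hL] := inclusion_curve_clamp b0.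
have Ssup : has_sup S by [].
have seq_ex (n : nat) : exists k, [/\ inclusion_curve lo hi 0 b k, k b = x &
    sup S - n.+1%:R^-1 < path_integral F 0 b k].
  have n0 : 0 < n.+1%:R^-1 :> R by rewrite invr_gt0.
  have [_ [k [kadm kb] <-] h] := sup_adherent n0 Ssup.
  by exists k.
have [kn hkn] := choice seq_ex.
(* The curves are only constrained on [0, b]: extend them by constants. *)
pose kc n := kn n \o clamp 0 b.
have kc_eq n s : 0 <= s <= b -> kn n s = kc n s by move=> sb; rewrite /kc/= clamp_id.
have kc_adm n : inclusion_curve lo hi 0 b (kc n).
  by have [kadm _ _] := hkn n; exact: eq_inclusion_curve (kc_eq n) kadm.
have kcJ n : path_integral F 0 b (kn n) = path_integral F 0 b (kc n).
  by apply: eq_Rintegral => s; rewrite inE/= in_itv => /kc_eq ->.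
have kcL : (kc @ \oo) [set k | (forall x y, x <= y -> `|k y - k x| <= L * (y - x)) /\
    (forall x, 0 <= k x <= 1)].
  by exists 0%N => // n _; have [kadm _ _] := hkn n; exact: hL.
have [G [k [PG kcG kL k01 Gk]]] := lipschitz_family_cluster _ L0 kcL.
have kcont := lipschitz_continuous kL.
have Gadm : G [set k' | inclusion_curve lo hi 0 b k' /\ k' b = x].
  apply: kcG; exists 0%N => // n _; split; first exact: kc_adm.
  by have [_ <- _] := hkn n; rewrite kc_eq// b0 lexx.
have Gpt s : (fun k' : R -> R => k' s) @ G --> k s.
  exact: continuously_cvg_pointwise Gk s.
have kadm : inclusion_curve lo hi 0 b k.
  apply: (inclusion_curve_limit PG kcont) => //.
  by apply: filterS Gadm => k' [].
have kb : k b = x.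
  apply: (@cvg_unique _ (@Rhausdorff R) _ _ _ _ (Gpt b)).
  apply: cvg_near_cst; apply: filterS Gadm => k' [_ ->] //.
exists k; split => // k' k'adm k'b.
apply: (@le_trans _ _ (sup S)); first by apply: sup_ubound => //; exists k'.
apply/ler_addgt0Pr => e e0.
have e2 : 0 < e / 2 by rewrite divr_gt0.
(* The error is integrated over a segment of length b, which may be zero. *)
have eb : 0 < e / 2 / (b + 1) by rewrite divr_gt0// ltr_wpDl.
have GF := @near_uniform_along R F 0 b _ G k PG F_cont kcont Gk eb.
have GJ : G [set k' | inclusion_curve lo hi 0 b k' /\
    sup S - e / 2 < path_integral F 0 b k'].
  apply: kcG.
  suff : \forall n \near \oo, inclusion_curve lo hi 0 b (kc n) /\
    sup S - e / 2 < path_integral F 0 b (kc n) by [].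
  near=> n; split; first exact: kc_adm.
  have [_ _ h] := hkn n; rewrite -kcJ (le_lt_trans _ h)// lerB//.
  by apply: ltW; near: n; exact: (near_infty_natSinv_lt (PosNum e2)).
have [k1 [k1F [k1adm k1J]]] := filter_ex (filterI GF GJ).
have : path_integral F 0 b k1 <= path_integral F 0 b k + e / 2 / (b + 1) * (b - 0).
  apply: le_path_integral => // s /k1F; rewrite ler_norml => /andP[_].
  by rewrite lerBlDl.
have : e / 2 / (b + 1) * (b - 0) <= e / 2.
  by rewrite subr0 mulrAC ler_pdivrMr ?ltr_wpDl// ler_pM2l// lerDl.
lra.
Unshelve. all: by end_near. Qed.
End existence.

(** * First-order behaviour of a curve at its endpoint *)

Lemma differentiable_expansion (R : realType) (phi : R * R -> R) (p : R * R) (e : R) :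
  differentiable phi p -> 0 < e ->
  \forall q \near p,
    `|phi q - phi p - ((q.1 - p.1) * 'D_(1, 0) phi p + (q.2 - p.2) * 'D_(0, 1) phi p)|
      <= e * Num.max `|q.1 - p.1| `|q.2 - p.2|.
Proof.
move=> dphi e0.
have /eqaddoP/(_ _ e0) h0 := diff_locally dphi.
have qp0 : (fun q : R * R => q - p) @ p --> (0 : R * R).
  rewrite -(subrr p); apply: cvgB; [exact: cvg_id|exact: cvg_cst].
have h1 : \forall q \near p, `|(phi \o shift p - (cst (phi p) + 'd phi p)) (q - p)|
    <= e * `|q - p| := qp0 _ h0.
apply: filterS h1 => q /=.
rewrite !fctE /= subrK prod_normE/= !deriveE//.
suff -> : 'd phi p (q - p) =
    (q.1 - p.1) * 'd phi p (1, 0) + (q.2 - p.2) * 'd phi p (0, 1).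
  by rewrite opprD addrA.
have -> : q - p = (q.1 - p.1) *: ((1, 0) : R * R) + (q.2 - p.2) *: ((0, 1) : R * R).
  apply/pair_equal_spec; split; rewrite /= /GRing.scale/=; ring.
by rewrite linearD !linearZ.
Qed.

Lemma near_left_segment (R : realType) (P : R -> Prop) (t : R) :
  (\forall s \near t, P s) -> \forall s \near t^'-, forall s', s <= s' <= t -> P s'.
Proof.
move=> [d /= d0 Pd]; near=> s => s' /andP[ss' s't].
apply: Pd; rewrite /ball_/= ger0_norm ?subr_ge0//.
have : t - d < s by near: s; apply: nbhs_left_gt; rewrite ltrBlDr ltrDl.
lra.
Unshelve. all: by end_near. Qed.

Section curve_germ.
Context (R : realType) (lo hi F : R -> R -> R).
Hypothesis lo_cont : continuous (fun p : R * R => lo p.1 p.2).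
Hypothesis hi_cont : continuous (fun p : R * R => hi p.1 p.2).
Hypothesis F_cont : continuous (fun p : R * R => F p.1 p.2).

Lemma path_integral_cat a m b k : a <= m -> m <= b ->
  inclusion_curve lo hi a b k ->
  path_integral F a b k = path_integral F a m k + path_integral F m b k.
Proof.
move=> am mb kadm.
have kint := inclusion_curve_integrable lo_cont hi_cont F_cont (le_trans am mb) kadm.
have mint : (@lebesgue_measure R).-integrable `]m, b] (EFin \o (fun s => F (k s) s)).
  by apply: integrableS kint => //; apply: subset_itvr; rewrite bnd_simp.
rewrite /path_integral -(Rintegral_itv_obnd_cbnd mint).
by rewrite -(Rintegral_itvB kint) ?bnd_simp// addrC subrK.
Qed.

Lemma near_left_along (H : R -> R -> R) a t k e : a < t ->
  continuous (fun p : R * R => H p.1 p.2) ->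
  inclusion_curve lo hi a t k -> 0 < e ->
  \forall s \near t^'-, forall s', s <= s' <= t ->
    `|H (k s') s' - H (k t) t| <= e.
Proof.
move=> alt Hc kadm e0; have at_ := ltW alt.
have [L L0 /(_ k kadm)[kL _]] := inclusion_curve_clamp lo_cont hi_cont at_.
have kc := lipschitz_continuous kL.
have := continuous_along Hc kc (x := t) => /cvgrPdist_le/(_ e e0)/near_left_segment h.
near=> s => s' /andP[ss' s't].
have as_ : a < s by near: s; exact: nbhs_left_gt.
have as' : a <= s' <= t by lra.
have : `|H (k (clamp a t t)) t - H (k (clamp a t s')) s'| <= e.
  by move: s' ss' s't {as'} => s' ss' s't; apply: (near h s) => //; rewrite ss' s't.
by rewrite distrC !clamp_id ?lexx ?at_.
Unshelve. all: by end_near. Qed.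

Lemma curve_near_left (P : R * R -> Prop) a t k : a < t ->
  inclusion_curve lo hi a t k -> (\forall p \near (k t, t), P p) ->
  \forall s \near t^'-, P (k s, s).
Proof.
move=> alt kadm Pkt; have at_ := ltW alt.
have [L L0 /(_ k kadm)[kL _]] := inclusion_curve_clamp lo_cont hi_cont at_.
have kc := lipschitz_continuous kL.
have h : \forall s \near t, P (k (clamp a t s), s).
  have kct : k (clamp a t s) @[s --> t] --> k (clamp a t t) := kc t.
  rewrite [X in _ --> k X]clamp_id ?lexx ?at_// in kct.
  exact: (cvg_pair kct cvg_id) Pkt.
near=> s.
have as_ : a < s by near: s; exact: nbhs_left_gt.
have st : s < t by near: s; exact: nbhs_left_lt.
have -> : k s = k (clamp a t s) by rewrite clamp_id// !ltW.
by near: s; exact: cvg_within h.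
Unshelve. all: by end_near. Qed.

(** Since [k] is Lipschitz, the remainder of the first-order expansion of [phi]
    along the curve is negligible with respect to [t - s]; [k] itself need not be
    differentiable at [t]. *)
Lemma curve_expansion phi a t k e : a < t -> inclusion_curve lo hi a t k ->
  differentiable phi (k t, t) -> 0 < e ->
  \forall s \near t^'-,
    `|phi (k t, t) - phi (k s, s)
      - ((k t - k s) * 'D_(1, 0) phi (k t, t) + (t - s) * 'D_(0, 1) phi (k t, t))|
      <= e * (t - s).
Proof.
move=> alt kadm dphi e0.
have [L L0 /(_ k kadm) kL] := inclusion_curve_lipschitz lo_cont hi_cont a t.
have L1 : 0 < L + 1 by rewrite addr_gt0.
have := curve_near_left alt kadm (differentiable_expansion dphi (divr_gt0 e0 L1)).
rewrite /= => h; near=> s.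
have as_ : a < s by near: s; exact: nbhs_left_gt.
have st : s < t by near: s; exact: nbhs_left_lt.
have ts0 : 0 <= t - s by rewrite subr_ge0 ltW.
rewrite -normrN.
have -> : forall x y d d' : R, - (x - y - ((k t - k s) * d + (t - s) * d')) =
  y - x - ((k s - k t) * d + (s - t) * d') by move=> *; ring.
apply: le_trans (_ : e / (L + 1) * Num.max `|k s - k t| `|s - t| <= _).
  by near: s.
rewrite mulrAC ler_pdivrMr// -mulrA ler_pM2l// ge_max; apply/andP; split.
  have := kL s t (ltW as_) (ltW st) (lexx t); rewrite distrC => /le_trans; apply.
  by rewrite mulrC ler_wpM2l// lerDl.
rewrite distrC ger0_norm// mulrDr mulr1 lerDr mulr_ge0// ltW//.
Unshelve. all: by end_near. Qed.

Lemma path_integral_germ a t k e : a < t -> inclusion_curve lo hi a t k -> 0 < e ->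
  \forall s \near t^'-,
    `|path_integral F s t k - F (k t) t * (t - s)| <= e * (t - s).
Proof.
move=> alt kadm e0; have h := near_left_along alt F_cont kadm e0.
near=> s.
have as_ : a < s by near: s; exact: nbhs_left_gt.
have st : s < t by near: s; exact: nbhs_left_lt.
have h' : forall s', s <= s' <= t -> `|F (k s') s' - F (k t) t| <= e by near: s.
have kint := inclusion_curve_integrable lo_cont hi_cont F_cont (ltW st)
  (inclusion_curve_sub (ltW as_) (lexx t) kadm).
rewrite ler_norml; apply/andP; split.
  rewrite -lerBlDr opprK -mulNr -mulrDl -(Rintegral_itv_cst _ (ltW st)).
  apply: le_Rintegral => //; first exact: cst_integrable_segment.
  move=> s'; rewrite /= in_itv/= => /h'.
  by rewrite ler_norml => /andP[+ _]; lra.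
rewrite lerBlDr -mulrDl -(Rintegral_itv_cst _ (ltW st)).
apply: le_Rintegral => //; first exact: cst_integrable_segment.
move=> s'; rewrite /= in_itv/= => /h'.
by rewrite ler_norml => /andP[_]; lra.
Unshelve. all: by end_near. Qed.

(** The left derivative of [k] at [t] need not exist; these bounds on the mean
    slopes take its place. *)
Lemma curve_slope a t k e : a < t -> inclusion_curve lo hi a t k -> 0 < e ->
  \forall s \near t^'-,
    (lo (k t) t - e) * (t - s) <= k t - k s <= (hi (k t) t + e) * (t - s).
Proof.
move=> alt kadm e0.
have hl := near_left_along alt lo_cont kadm e0.
have hh := near_left_along alt hi_cont kadm e0.
near=> s.
have as_ : a < s by near: s; exact: nbhs_left_gt.
have st : s < t by near: s; exact: nbhs_left_lt.
have hl' : forall s', s <= s' <= t -> `|lo (k s') s' - lo (k t) t| <= e by near: s.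
have hh' : forall s', s <= s' <= t -> `|hi (k s') s' - hi (k t) t| <= e by near: s.
have [_ h1] := kadm.2 s t (lo (k t) t - e) (ltW as_) (ltW st) (lexx t).
have [h2 _] := kadm.2 s t (hi (k t) t + e) (ltW as_) (ltW st) (lexx t).
apply/andP; split.
  by apply: h1 => s' /hl'; rewrite ler_norml => /andP[+ _]; lra.
by apply: h2 => s' /hh'; rewrite ler_norml => /andP[_]; lra.
Unshelve. all: by end_near. Qed.

End curve_germ.

(** * Dynamic programming and the viscosity inequalities *)

Lemma expR_mulK (R : realType) (x y : R) : expR x * expR y * expR (- y) = expR x.
Proof. by rewrite -!expRD addrK. Qed.

(** [p0] and [p1] stand for the values of the test function at the endpoint and
    at a point of the curve a time [h] before.  The inequality
    [p1 * exp J <= p0] enters through [1 + J <= exp J], with [J] close to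
    [f0 * h]. *)
Lemma slope_ge_of_increment (R : realType) (p0 p1 f0 e dt dx w h : R) : 0 < h ->
  p0 - p1 - (w * h * dx + h * dt) <= e * h ->
  p1 * (1 + (f0 - e) * h) <= p0 ->
  p0 * (f0 - e) - e <= p1 * (f0 - e) ->
  f0 * p0 <= dt + w * dx + e * (p0 + 2).
Proof.
move=> h0 h1 h2 h3.
have : (p0 * (f0 - e) - e) * h <= (w * dx + dt + e) * h.
  apply: (@le_trans _ _ (p1 * (f0 - e) * h)); first by rewrite ler_pM2r.
  by move: h1 h2; rewrite !mulrDl !mulrDr mulr1; lra.
by rewrite ler_pM2r//; lra.
Qed.

(** The counterpart for [p0 <= p1 * exp J], that is, [p0 * exp (- J) <= p1];
    here [dk] is the increment of the curve. *)
Lemma slope_le_of_increment (R : realType) (p0 p1 f0 e a dt dx w dk h : R) :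
  - (e * h) <= p0 - p1 - (dk + h * dt) ->
  p0 * (1 - (f0 + e) * h) <= p1 ->
  (w * dx - e * a) * h <= dk ->
  (dt + w * dx) * h <= (f0 * p0 + e * (p0 + 1 + a)) * h.
Proof. by rewrite !(mulrDl, mulrDr, mulrBr, mulrBl) mulr1; lra. Qed.

Section viscosity.
Context (R : realType) (lo hi F V : R -> R -> R).
Hypothesis lo_cont : continuous (fun p : R * R => lo p.1 p.2).
Hypothesis hi_cont : continuous (fun p : R * R => hi p.1 p.2).
Hypothesis F_cont : continuous (fun p : R * R => F p.1 p.2).
Hypothesis lo_le0 : forall x s, lo x s <= 0.
Hypothesis hi_ge0 : forall x s, 0 <= hi x s.
Hypothesis V_attained : forall x t, 0 <= x <= 1 -> 0 <= t ->
  exists k, [/\ inclusion_curve lo hi 0 t k, k t = x &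
    V x t = expR (path_integral F 0 t k)].
Hypothesis V_ub : forall t k, 0 <= t -> inclusion_curve lo hi 0 t k ->
  expR (path_integral F 0 t k) <= V (k t) t.

(** One half of the dynamic programming principle: an optimal curve up to time
    [s] can be continued by any curve issued from its endpoint. *)
Lemma value_along_curve s t k : 0 <= s -> s <= t -> inclusion_curve lo hi s t k ->
  V (k s) s * expR (path_integral F s t k) <= V (k t) t.
Proof.
move=> s0 st kadm.
have ks01 : 0 <= k s <= 1 by apply: kadm.1; rewrite lexx.
have [k1 [k1adm k1s ->]] := V_attained ks01 s0.
pose k2 x := if x <= s then k1 x else k x.
have k12 x : 0 <= x <= s -> k1 x = k2 x by rewrite /k2 => /andP[_ ->].
have kk2 x : s <= x <= t -> k x = k2 x.
  rewrite /k2; case: (leP x s) => // xs /andP[sx _].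
  by have -> : x = s by apply/le_anti; rewrite xs.
have k2adm : inclusion_curve lo hi 0 t k2.
  apply: (@inclusion_curve_cat _ _ _ 0 s t) => //.
    exact: eq_inclusion_curve k12 k1adm.
  exact: eq_inclusion_curve kk2 kadm.
have := V_ub (le_trans s0 st) k2adm.
rewrite -kk2 ?lexx ?st//; apply: le_trans.
rewrite (path_integral_cat lo_cont hi_cont F_cont s0 st k2adm) expRD.
rewrite le_eqVlt; apply/orP; left; apply/eqP; congr (expR _ * expR _).
  by apply: eq_Rintegral => x; rewrite inE/= in_itv/= => /k12 ->.
by apply: eq_Rintegral => x; rewrite inE/= in_itv/= => /kk2 ->.
Qed.

Lemma value_gt0 x t : 0 <= x <= 1 -> 0 <= t -> 0 < V x t.
Proof. by move=> x01 t0; have [k [_ _ ->]] := V_attained x01 t0; exact: expR_gt0. Qed.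

(** The endpoint [x] is prescribed at the final time [t], so competitors may
    differ in the past: the straight line of slope [w] arriving at [(x, t)] is
    itself a curve of the inclusion near [t], and no differential equation has to
    be solved.  By [value_along_curve], the value at the endpoint, which is that
    of [phi], bounds from above the earlier values of [V] along the line, hence
    those of [phi]. *)
Lemma supersolution_slope_near (phi : R * R -> R) (x t w : R) :
  differentiable phi (x, t) ->
  0 < x < 1 -> 0 < t -> phi (x, t) = V x t ->
  (\forall p \near (x, t), phi p <= V p.1 p.2) ->
  (\forall p \near (x, t), lo p.1 p.2 <= w <= hi p.1 p.2) ->
  F x t * phi (x, t) <= 'D_(0, 1) phi (x, t) + w * 'D_(1, 0) phi (x, t).
Proof.
move=> dphi /andP[x0 x1] t0 phiV phi_le w_near.
set p0 := phi (x, t); set f0 := F x t.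
have x01 : 0 <= x <= 1 by rewrite !ltW.
have p00 : 0 < p0 by rewrite /p0 phiV value_gt0// ltW.
pose k s := x + w * (s - t).
have kt : k t = x by rewrite /k subrr mulr0 addr0.
have kc : (fun s => (k s, s)) @ t --> (x, t).
  have kct : k @ t --> k t.
    apply: cvgD; first exact: cvg_cst.
    by apply: cvgMl_tmp; apply: cvgB; [exact: cvg_id|exact: cvg_cst].
  by rewrite -[X in _ --> (X, _)]kt; exact: cvg_pair kct cvg_id.
have box_near : \forall p \near (x, t), 0 < p.1 < 1.
  have xin : x \in `]0, 1[ by rewrite in_itv/= x0.
  have x_near : \forall y \near x, 0 < y < 1.
    by apply: filterS (near_in_itvoo xin) => y; rewrite in_itv.
  have fst_cvg : (fun p : R * R => p.1) @ (x, t) --> x by exact: cvg_fst.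
  exact: fst_cvg x_near.
have good : \forall s \near t, (0 < k s < 1) /\ lo (k s) s <= w <= hi (k s) s.
  exact: kc (filterI box_near w_near).
have [a [a0 at_ kadm]] : exists a, [/\ 0 < a, a < t & inclusion_curve lo hi a t k].
  suff : \forall a \near t^'-, [/\ 0 < a, a < t & inclusion_curve lo hi a t k].
    by move=> /filter_ex.
  have := near_left_segment good => hgood; near=> a.
  have ha : forall s, a <= s <= t -> (0 < k s < 1) /\ lo (k s) s <= w <= hi (k s) s.
    by near: a.
  split; [by near: a; exact: nbhs_left_gt|by near: a; exact: nbhs_left_lt|].
  apply: inclusion_curve_line => s /ha[/andP[? ?] ?]//.
  by rewrite !ltW.
apply/ler_addgt0Pr => e' e'0.
have p02 : 0 < p0 + 2 by rewrite addr_gt0.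
pose e := e' / (p0 + 2); have e0 : 0 < e by exact: divr_gt0.
have pc : phi @ (x, t) --> p0 by exact: differentiable_continuous.
have dphi' : differentiable phi (k t, t) by rewrite kt.
have H1 := curve_expansion lo_cont hi_cont at_ kadm dphi' e0.
have H2 := path_integral_germ lo_cont hi_cont F_cont at_ kadm e0.
have phi_le' : \forall p \near (k t, t), phi p <= V p.1 p.2 by rewrite kt.
have H3 := curve_near_left lo_cont hi_cont at_ kadm phi_le'.
have near4 : \forall p \near (k t, t), p0 * (f0 - e) - e <= phi p * (f0 - e).
  rewrite kt; have : (fun p => phi p * (f0 - e)) @ (x, t) --> p0 * (f0 - e).
    exact: cvgMr_tmp.
  move=> /cvgrPdist_le/(_ e e0); apply: filterS => p.
  by rewrite ler_norml => /andP[_]; lra.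
have H4 := curve_near_left lo_cont hi_cont at_ kadm near4.
have near5 : \forall p \near (k t, t), 0 < phi p.
  by rewrite kt; move/cvgr_gt : pc; apply.
have H5 := curve_near_left lo_cont hi_cont at_ kadm near5.
near t^'- => s.
have as_ : a < s by near: s; exact: nbhs_left_gt.
have st : s < t by near: s; exact: nbhs_left_lt.
have h1 : `|phi (k t, t) - phi (k s, s)
    - ((k t - k s) * 'D_(1, 0) phi (k t, t) + (t - s) * 'D_(0, 1) phi (k t, t))|
    <= e * (t - s) by near: s.
have h2 : `|path_integral F s t k - F (k t) t * (t - s)| <= e * (t - s) by near: s.
have h3 : phi (k s, s) <= V (k s) s by near: s.
have h4 : p0 * (f0 - e) - e <= phi (k s, s) * (f0 - e) by near: s.
have h5 : 0 < phi (k s, s) by near: s.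
have s0 : 0 <= s by rewrite ltW// (lt_trans a0).
have sadm := inclusion_curve_sub (ltW as_) (lexx t) kadm.
have dpp := value_along_curve s0 (ltW st) sadm.
rewrite kt -/p0 -/f0 in h1 h2 dpp.
have ts0 : 0 < t - s by rewrite subr_gt0.
have J1 : 1 + (f0 - e) * (t - s) <= expR (path_integral F s t k).
  apply: le_trans (expR_ge1Dx _); rewrite lerD2l.
  by move: h2; rewrite ler_norml => /andP[+ _]; lra.
have dpp2 : phi (k s, s) * (1 + (f0 - e) * (t - s)) <= p0.
  rewrite /p0 phiV; apply: le_trans dpp.
  apply: (@le_trans _ _ (phi (k s, s) * expR (path_integral F s t k))).
    by rewrite ler_pM2l.
  by rewrite ler_wpM2r// expR_ge0.
have ks : x - k s = w * (t - s) by rewrite /k; ring.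
move: h1; rewrite ks ler_norml => /andP[_ h1].
have -> : e' = e * (p0 + 2) by rewrite /e divfK ?gt_eqF.
exact: slope_ge_of_increment ts0 h1 dpp2 h4.
Unshelve. all: by end_near. Qed.

(** A slope at the edge of [lo x t, hi x t] need not be admissible at
    neighbouring points.  For [0 <= c < 1], however, [c * w] is either zero or
    strictly inside the edge it approaches, hence admissible nearby by
    continuity; let [c] tend to 1. *)
Lemma supersolution_slope (phi : R * R -> R) (x t w : R) :
  differentiable phi (x, t) -> 0 < x < 1 -> 0 < t -> phi (x, t) = V x t ->
  (\forall p \near (x, t), phi p <= V p.1 p.2) -> lo x t <= w <= hi x t ->
  F x t * phi (x, t) <= 'D_(0, 1) phi (x, t) + w * 'D_(1, 0) phi (x, t).
Proof.
move=> dphi x01 t0 phiV phi_le /andP[low whi].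
have h (c : R) : 0 <= c < 1 ->
    F x t * phi (x, t) <= 'D_(0, 1) phi (x, t) + (c * w) * 'D_(1, 0) phi (x, t).
  move=> /andP[c0 c1]; apply: supersolution_slope_near => //.
  have [w0|w0|w0] := ltgtP w 0.
  - have lo_lt : lo x t < c * w by rewrite (le_lt_trans low)// ltr_nMl.
    have h1 : \forall p \near (x, t), lo p.1 p.2 < c * w.
      by have /cvgr_lt := @lo_cont (x, t); apply.
    apply: filterS h1 => p /ltW ->/=; apply: le_trans (hi_ge0 _ _).
    by rewrite mulr_ge0_le0// ltW.
  - have hi_gt : c * w < hi x t by rewrite (lt_le_trans _ whi)// gtr_pMl.
    have h1 : \forall p \near (x, t), c * w < hi p.1 p.2.
      by have /cvgr_gt := @hi_cont (x, t); apply.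
    apply: filterS h1 => p /ltW ->; rewrite andbT; apply: le_trans (lo_le0 _ _) _.
    by rewrite mulr_ge0// ltW.
  - by near=> p; rewrite w0 mulr0 lo_le0 hi_ge0.
have : (fun c => 'D_(0, 1) phi (x, t) + (c * w) * 'D_(1, 0) phi (x, t)) @ 1^'- -->
    'D_(0, 1) phi (x, t) + (1 * w) * 'D_(1, 0) phi (x, t).
  apply: cvg_at_left_filter; apply: cvgD; first exact: cvg_cst.
  by apply: cvgMr_tmp; apply: cvgMr_tmp; exact: cvg_id.
rewrite mul1r => /cvgr_to_ge; apply; near=> c; apply: h; apply/andP; split.
  by near: c; apply: nbhs_left_ge.
by near: c; exact: nbhs_left_lt.
Unshelve. all: by end_near. Qed.

(** Follow an optimal curve back from [(x, t)].  Its mean slopes need not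
    converge, but they are asymptotically between [lo x t] and [hi x t], and the
    left-hand side is affine in the slope, so one of the two edges does at least
    as well. *)
Lemma subsolution_slope (phi : R * R -> R) (x t : R) :
  differentiable phi (x, t) -> 0 < x < 1 -> 0 < t -> phi (x, t) = V x t ->
  (\forall p \near (x, t), V p.1 p.2 <= phi p) ->
  exists2 w, w = lo x t \/ w = hi x t &
    'D_(0, 1) phi (x, t) + w * 'D_(1, 0) phi (x, t) <= F x t * phi (x, t).
Proof.
move=> dphi /andP[x0 x1] t0 phiV V_le.
set p0 := phi (x, t); set f0 := F x t; set dx := 'D_(1, 0) phi (x, t).
have x01 : 0 <= x <= 1 by rewrite !ltW.
have p00 : 0 < p0 by rewrite /p0 phiV value_gt0// ltW.
have [k [kadm kt Vk]] := V_attained x01 (ltW t0).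
pose w := if 0 <= dx then lo x t else hi x t.
exists w; first by rewrite /w; case: ifP; [left|right].
apply/ler_addgt0Pr => e' e'0.
have p02 : 0 < p0 + 1 + `|dx| by rewrite ltr_wpDr// addr_gt0.
pose e := e' / (p0 + 1 + `|dx|); have e0 : 0 < e by exact: divr_gt0.
have dphi' : differentiable phi (k t, t) by rewrite kt.
have H1 := curve_expansion lo_cont hi_cont t0 kadm dphi' e0.
have H2 := path_integral_germ lo_cont hi_cont F_cont t0 kadm e0.
have V_le' : \forall p \near (k t, t), V p.1 p.2 <= phi p by rewrite kt.
have H3 := curve_near_left lo_cont hi_cont t0 kadm V_le'.
have H4 := curve_slope lo_cont hi_cont t0 kadm e0.
near t^'- => s.
have s0 : 0 < s by near: s; exact: nbhs_left_gt.
have st : s < t by near: s; exact: nbhs_left_lt.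
have h1 : `|phi (k t, t) - phi (k s, s)
    - ((k t - k s) * 'D_(1, 0) phi (k t, t) + (t - s) * 'D_(0, 1) phi (k t, t))|
    <= e * (t - s) by near: s.
have h2 : `|path_integral F s t k - F (k t) t * (t - s)| <= e * (t - s) by near: s.
have h3 : V (k s) s <= phi (k s, s) by near: s.
have h4 : (lo (k t) t - e) * (t - s) <= k t - k s <= (hi (k t) t + e) * (t - s).
  by near: s.
have ts0 : 0 < t - s by rewrite subr_gt0.
have Vks : expR (path_integral F 0 s k) <= V (k s) s.
  by apply: V_ub; [exact: ltW|exact: inclusion_curve_sub (lexx 0) (ltW st) kadm].
rewrite kt -/p0 -/f0 -/dx in h1 h2 h4.
have p0E : p0 = expR (path_integral F 0 s k) * expR (path_integral F s t k).
  rewrite /p0 phiV Vk -expRD; congr expR.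
  exact: path_integral_cat (ltW s0) (ltW st) kadm.
have back : p0 * (1 - (f0 + e) * (t - s)) <= phi (k s, s).
  apply: le_trans h3; apply: le_trans Vks.
  have -> : expR (path_integral F 0 s k) = p0 * expR (- path_integral F s t k).
    by rewrite -(expR_mulK _ (path_integral F s t k)) -p0E.
  rewrite ler_pM2l//; apply: le_trans (expR_ge1Dx _); rewrite lerD2l.
  move: h2; rewrite ler_norml => /andP[_ h2].
  by rewrite lerN2 mulrDl addrC -lerBlDr.
have slope : (w * dx - e * `|dx|) * (t - s) <= (x - k s) * dx.
  move: h4 => /andP[h4 h4']; rewrite /w; case: (leP 0 dx) => dx0.
    by rewrite (ger0_norm dx0) -mulrBl mulrAC ler_wpM2r.
  by rewrite (ltr0_norm dx0) mulrN opprK -mulrDl mulrAC ler_nM2r.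
move: h1; rewrite ler_norml => /andP[h1 _].
have := slope_le_of_increment h1 back slope.
rewrite ler_pM2r// => /le_trans; apply.
by rewrite lerD2l /e divfK ?gt_eqF.
Unshelve. all: by end_near. Qed.

End viscosity.

(** * Derivatives of curves *)

Section derivative_bounds.
Context (R : realType) (lo hi : R -> R -> R).
Hypothesis lo_cont : continuous (fun p : R * R => lo p.1 p.2).
Hypothesis hi_cont : continuous (fun p : R * R => hi p.1 p.2).

(** Left difference quotients suffice. *)
Lemma derivative_in_bounds (T x u : R) (k : R -> R) : 0 < x < T ->
  inclusion_curve lo hi 0 T k ->
  (fun h => h^-1 * (k (h + x) - k x)) @ 0^' --> u ->
  lo (k x) x <= u <= hi (k x) x.
Proof.
move=> /andP[x0 xT] kadm /cvg_dnbhs_at_left ku.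
have kadm' := inclusion_curve_sub (lexx 0) (ltW xT) kadm.
suff h e : 0 < e -> lo (k x) x - e <= u <= hi (k x) x + e.
  by apply/andP; split; apply/ler_addgt0Pr => e /h /andP[h1 h2]; lra.
move=> e0; have [d /= d0 hd] := curve_slope lo_cont hi_cont x0 kadm' e0.
suff hh : \forall h \near 0^'-,
    lo (k x) x - e <= h^-1 * (k (h + x) - k x) <= hi (k x) x + e.
  by apply/andP; split; [apply: (cvgr_to_ge ku)|apply: (cvgr_to_le ku)];
    apply: filterS hh => h /andP[].
near=> h.
have h0 : h < 0 by near: h; exact: nbhs_left_lt.
have hd' : - d < h by near: h; apply: nbhs_left_gt; rewrite oppr_lt0.
have kk : (lo (k x) x - e) * (- h) <= k x - k (h + x) <= (hi (k x) x + e) * (- h).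
  have -> : - h = x - (h + x) by ring.
  apply: hd; last by rewrite gtrDr.
  by rewrite /ball_/= opprD addrCA subrr addr0 normrN ltr0_norm// ltrNl.
move: kk => /andP[kk1 kk2].
by rewrite ler_ndivlMl// ler_ndivrMl//; apply/andP; split; lra.
Unshelve. all: by end_near. Qed.

End derivative_bounds.

(** * Linear differential equations *)

Lemma integral_segmentB (R : realType) (h : R -> R) (a s t : R) :
  continuous h -> a <= s -> s <= t ->
  \int[@lebesgue_measure R]_(x in `[a, t]) h x -
  \int[@lebesgue_measure R]_(x in `[a, s]) h x =
  \int[@lebesgue_measure R]_(x in `[s, t]) h x.
Proof.
move=> hc as_ st; rewrite -[RHS]Rintegral_itv_obnd_cbnd; last first.
  apply: integrableS (continuous_integrable_segment s t hc) => //.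
  exact: subset_itv_oc_cc.
rewrite -(Rintegral_itvB (continuous_integrable_segment a t hc)) ?bnd_simp//.
Qed.

(** The lower bound [a] lies strictly below [t]; taking [a = -1] in what follows
    makes the integral two-sided differentiable on all of [0, T]. *)
Lemma is_derive_integral (R : realType) (h : R -> R) (a t : R) :
  continuous h -> a < t ->
  is_derive t 1 (fun y => \int[@lebesgue_measure R]_(x in `[a, y]) h x) (h t).
Proof.
move=> hc at_.
have tu : t < t + 1 by rewrite ltrDl.
have hint := continuous_integrable_segment a (t + 1) hc.
have [d1 d2] := continuous_FTC1_closed tu hint at_ (hc t).
by apply: DeriveDef; [exact: d1|rewrite -derive1E; exact: d2].
Qed.

(** The product of [y] and [exp (- P)], where [P] is a primitive of [h], has zero
    derivative. *)
Lemma linear_ode_exp (R : realType) (h q y : R -> R) (T : R) : 0 <= T ->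
  continuous h -> continuous q ->
  (forall t, 0 <= t <= T -> y t = y 0 + \int[@lebesgue_measure R]_(s in `[0, t]) q s) ->
  (forall t, 0 <= t <= T -> q t = h t * y t) ->
  y T = y 0 * expR (\int[@lebesgue_measure R]_(s in `[0, T]) h s).
Proof.
move=> T0 hc qc yE qE.
have N10 : -1 < 0 :> R by rewrite oppr_lt0.
pose P t := \int[@lebesgue_measure R]_(s in `[-1, t]) h s.
pose Q t := \int[@lebesgue_measure R]_(s in `[-1, t]) q s.
pose Z t := (y 0 + Q t - Q 0) * expR (- P t).
have yQ t : 0 <= t <= T -> y t = y 0 + Q t - Q 0.
  move=> /[dup] tT /andP[t0 _]; rewrite yE// -addrA.
  by rewrite (integral_segmentB qc (ltW N10) t0).
have dZ t : 0 <= t <= T -> is_derive t 1 Z 0.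
  move=> /andP[t0 tT]; have t1 : -1 < t by exact: lt_le_trans t0.
  have dQ : is_derive t 1 (fun t => y 0 + Q t - Q 0) (q t).
    have dQ := is_derive_integral qc t1.
    have dQ' := is_deriveB (is_deriveD (is_derive_cst (y 0) t 1) dQ)
      (is_derive_cst (Q 0) t 1).
    by apply: (is_derive_eq dQ'); rewrite add0r subr0.
  have dP : is_derive t 1 (fun t => expR (- P t)) (expR (- P t) * - h t).
    have dP := is_derive_integral hc t1.
    exact: (is_derive1_comp (is_derive_expR _) (is_deriveN dP)).
  apply: (is_derive_eq (is_deriveM dQ dP)).
  rewrite /GRing.scale/= -yQ ?t0// qE ?t0//; ring.
have Zc : {within `[0, T], continuous Z}.
  by apply: derivable_within_continuous => t; rewrite in_itv/= => /dZ[].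
have [|c _] := @MVT_segment _ Z (fun=> 0) 0 T T0 _ Zc.
  by move=> t; rewrite in_itv/= => /andP[t0 tT]; apply: dZ; rewrite !ltW.
have yT : y T = y 0 + Q T - Q 0 by apply: yQ; rewrite lexx T0.
rewrite mul0r /Z -yT addrK => /subr0_eq ZE.
rewrite -(integral_segmentB hc (ltW N10) T0) -/(P T) -/(P 0) expRD mulrCA -ZE mulrC.
by rewrite -mulrA -expRD addNr expR0 mulr1.
Qed.

Lemma exp_solves_linear_ode (R : realType) (h : R -> R) (t : R) : 0 <= t ->
  continuous h ->
  let y (t : R) := expR (\int[@lebesgue_measure R]_(s in `[-1, t]) h s) in
  y t = y 0 + \int[@lebesgue_measure R]_(s in `[0, t]) (h s * y s).
Proof.
move=> t0 hc y.
have N10 : -1 < 0 :> R by rewrite oppr_lt0.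
have dy (s : R) : 0 <= s -> is_derive s 1 y (y s * h s).
  move=> s0; have dP := is_derive_integral hc (lt_le_trans N10 s0).
  exact: (is_derive1_comp (is_derive_expR _) dP).
have [->|tn0] := eqVneq t 0; first by rewrite set_itv1 Rintegral_set1 addr0.
have tp : 0 < t by rewrite lt_neqAle eq_sym tn0.
have yc (s : R) : 0 <= s -> {for s, continuous y}.
  by move=> s0; apply/differentiable_continuous/derivable1_diffP; case: (dy s s0).
rewrite /Rintegral (@continuous_FTC2 _ (fun s => h s * y s) y)//=.
- by rewrite [RHS]addrC subrK.
- apply: continuous_in_subspaceT => s; rewrite inE/= in_itv/= => /andP[s0 _].
  by apply: cvgM; [exact: hc|exact: yc].
- split.
  + by move=> s; rewrite in_itv/= => /andP[s0 _]; case: (dy s (ltW s0)).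
  + by apply: cvg_at_right_filter; exact: yc.
  + by apply: cvg_at_left_filter; exact: yc.
- move=> s; rewrite in_itv/= => /andP[s0 _]; rewrite derive1E.
  by have [_ ->] := dy s (ltW s0); rewrite mulrC.
Qed.

(** * Trajectories of the control system *)

Lemma continuous_fst_comp (R : realType) (d : R -> R) :
  continuous d -> continuous (fun p : R * R => d p.1).
Proof.
move=> dc p.
have p1 : (fun p : R * R => p.1) @ p --> p.1 by case: p => p1 p2; exact: cvg_fst.
exact: (@cvg_comp _ _ _ _ _ _ _ _ p1 (dc p.1)).
Qed.

Lemma box_integrable (R : realType) (G : R * R -> R) (B a b c d : R) :
  measurable_fun setT G -> (forall p, `|G p| <= B) ->
  ((@lebesgue_measure R) \x (@lebesgue_measure R))%E.-integrable
    (`[a, b]%classic `*` `[c, d]%classic) (EFin \o G).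
Proof.
move=> Gm GB.
have m1 : measurable (`[a, b]%classic : set (measurableTypeR R)) by [].
have m2 : measurable (`[c, d]%classic : set (measurableTypeR R)) by [].
apply: measurable_bounded_integrable.
- exact: measurableX.
- suff : (((@lebesgue_measure R) \x (@lebesgue_measure R))
      (`[a, b]%classic `*` `[c, d]%classic) < +oo)%E by [].
  rewrite product_measure1E//.
  have fin x y : (@lebesgue_measure R `[x, y]%classic < +oo)%E.
    by rewrite lebesgue_measure_itv/=; case: ifP => _; rewrite -?EFinB ltry.
  by apply: lte_mul_pinfty => //; rewrite ?ge0_fin_numE//; exact: fin.
- exact: measurable_funS Gm.
- exists B; split; first exact: num_real.
  by move=> M hM p _ /=; exact: le_trans (ltW hM).
Qed.

Section trajectories.
Context (R : realType) (g f : R -> R -> R) (dmin dmax : R -> R).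
Let lo x s := g (clamp 0 1 x) s * dmin (clamp 0 1 x).
Let hi x s := g (clamp 0 1 x) s * dmax (clamp 0 1 x).
Let F x s := f (clamp 0 1 x) s.
Hypothesis g_cont : continuous (fun p : R * R => g (clamp 0 1 p.1) p.2).
Hypothesis f_cont : continuous (fun p : R * R => f (clamp 0 1 p.1) p.2).
Hypothesis dmin_cont : continuous (dmin \o clamp 0 1).
Hypothesis dmax_cont : continuous (dmax \o clamp 0 1).
Hypothesis g_gt0 : forall k t, 0 <= k <= 1 -> 0 < g k t.
Hypothesis dmin_le0 : forall k, 0 <= k <= 1 -> dmin k <= 0.
Hypothesis dmax_ge0 : forall k, 0 <= k <= 1 -> 0 <= dmax k.

Lemma rate_bound_continuous (d : R -> R) : continuous (d \o clamp 0 1) ->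
  continuous (fun p : R * R => g (clamp 0 1 p.1) p.2 * d (clamp 0 1 p.1)).
Proof.
move=> dc p; apply: cvgM; first exact: g_cont.
exact: (continuous_fst_comp dc (x := p)).
Qed.

Lemma caratheodory_increment (T : R) (x G : R -> R) s1 s2 :
  caratheodory T x G -> 0 <= s1 -> s1 <= s2 -> s2 <= T ->
  (@lebesgue_measure R).-integrable `[s1, s2] (EFin \o G) /\
  x s2 - x s1 = \int[@lebesgue_measure R]_(s in `[s1, s2]) G s.
Proof.
move=> [Gint xE] s10 s12 s2T.
have s20 : 0 <= s2 by exact: le_trans s12.
have Gi a b : 0 <= a -> b <= T ->
    (@lebesgue_measure R).-integrable `[a, b] (EFin \o G).
  move=> a0 bT; apply: integrableS Gint => //.
  by apply: subset_itv; rewrite bnd_simp.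
split; first exact: Gi.
rewrite (xE s1) ?s10 ?(le_trans s12)// (xE s2) ?s20//.
rewrite opprD addrACA subrr add0r -[RHS]Rintegral_itv_obnd_cbnd; last first.
  by apply: integrableS (Gi _ _ s10 s2T) => //; exact: subset_itv_oc_cc.
by rewrite -(Rintegral_itvB (Gi _ _ (lexx 0) s2T)) ?bnd_simp.
Qed.

Lemma trajectory_inclusion_curve T nu r k : controls dmin dmax nu ->
  trajectory g f nu T r k -> inclusion_curve lo hi 0 T k.
Proof.
move=> [_ nu_bounds] [_ rk _ kcar]; split; first by move=> s /rk[].
move=> s1 s2 M s10 s12 s2T.
have [Gint ->] := caratheodory_increment kcar s10 s12 s2T.
have bounds s : s1 <= s <= s2 ->
    lo (k s) s <= g (k s) s * nu (k s) s <= hi (k s) s.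
  move=> /andP[s1s ss2]; have sT : 0 <= s <= T by lra.
  have [_ k01] := rk _ sT.
  have [h1 h2 _ _] := nu_bounds (k s) s k01 (ltac:(lra)).
  by rewrite /lo /hi clamp_id// !ler_pM2l ?g_gt0// h1.
split=> h; rewrite -(Rintegral_itv_cst _ s12); apply: le_Rintegral => //;
  try exact: cst_integrable_segment.
  move=> s; rewrite /= in_itv/= => ss; have /andP[_ h2] := bounds s ss.
  exact: le_trans h2 (h s ss).
move=> s; rewrite /= in_itv/= => ss; have /andP[h1 _] := bounds s ss.
exact: le_trans (h s ss) h1.
Qed.

Let lo_cont : continuous (fun p : R * R => lo p.1 p.2) :=
  rate_bound_continuous dmin_cont.
Let hi_cont : continuous (fun p : R * R => hi p.1 p.2) :=
  rate_bound_continuous dmax_cont.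

Let F_cont : continuous (fun p : R * R => F p.1 p.2) := f_cont.

(** The component [r] solves a linear equation whose coefficient depends on [k]
    only. *)
Lemma trajectory_payoff T nu r k : 0 <= T -> controls dmin dmax nu ->
  trajectory g f nu T r k -> r T / r 0 = expR (path_integral F 0 T k).
Proof.
move=> T0 nuA traj; have kadm := trajectory_inclusion_curve nuA traj.
have [r0 rk [Gint rE] _] := traj.
have [L L0 /(_ k kadm)[kL k01]] := inclusion_curve_clamp lo_cont hi_cont T0.
pose kc s := k (clamp 0 T s).
have kcc : continuous kc := lipschitz_continuous kL.
pose rc s := r (clamp 0 T s).
have rcc : continuous rc.
  pose PI t := r 0 + parameterized_integral (@lebesgue_measure R) 0 (clamp 0 T t)
    (fun s => f (k s) s * r s).
  have -> : rc = PI.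
    by apply/funext => t; rewrite /rc rE//; exact: clamp_bounds.
  move=> t; apply: cvgD; first exact: cvg_cst.
  exact: (clamp_within_continuous T0 (parameterized_integral_continuous T0 Gint)).
have hc := continuous_along F_cont kcc.
have Eh t : 0 <= t <= T -> f (clamp 0 1 (kc t)) t = f (k t) t.
  by move=> tT; rewrite /kc (clamp_id tT) clamp_id//; have [] := rk _ tT.
have Erc t : 0 <= t <= T -> rc t = r t by move=> tT; rewrite /rc clamp_id.
rewrite (@linear_ode_exp _ (fun s => f (clamp 0 1 (kc s)) s)
    (fun s => f (clamp 0 1 (kc s)) s * rc s) r T T0 hc).
- rewrite mulrAC mulfV ?gt_eqF// mul1r; congr expR.
  apply: eq_Rintegral => s; rewrite inE/= in_itv/= => sT.
  by rewrite Eh// /F clamp_id//; have [] := rk _ sT.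
- by move=> s; apply: cvgM; [exact: hc|exact: rcc].
- move=> t /[dup] tT /andP[t0 tT']; rewrite rE//; congr (_ + _).
  apply: eq_Rintegral => s; rewrite inE/= in_itv/= => /andP[s0 st].
  have sT : 0 <= s <= T by rewrite s0 (le_trans st).
  by rewrite Eh// Erc.
- by move=> t tT; rewrite Erc.
Qed.

(** A feedback control needs to be prescribed only on the graph of the curve,
    where it is set to [k' / g]; off the graph it is zero.  Almost everywhere
    this quotient satisfies the constraints: it lies between the bounds, and it is
    zero where the curve touches 0 or 1, since those are extrema.  The
    exceptional points, at which the constraints must still hold, are absorbed by
    truncation. *)
Lemma curve_control T k : 0 <= T -> inclusion_curve lo hi 0 T k ->
  exists2 nu, controls dmin dmax nu &
    caratheodory T (k \o clamp 0 T)
      (fun s => g (k (clamp 0 T s)) s * nu (k (clamp 0 T s)) s).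
Proof.
move=> T0 kadm.
have [L L0 /(_ k kadm)[kL k01]] := inclusion_curve_clamp lo_cont hi_cont T0.
pose kc s := k (clamp 0 T s).
have kcc : continuous kc := lipschitz_continuous kL.
have kk t : 0 <= t <= T -> k t = kc t by move=> tT; rewrite /kc clamp_id.
have kcadm := eq_inclusion_curve kk kadm.
have [u [uint ku u']] := lipschitz_ae_derivative T0 kL.
pose gk s := g (clamp 0 1 (kc s)) s.
have gkc : continuous gk :=
  @continuous_along _ (fun x s => g (clamp 0 1 x) s) _ g_cont kcc.
have gk0 s : 0 < gk s by apply: g_gt0; exact: clamp_bounds.
have gkE s : gk s = g (kc s) s by rewrite /gk clamp_id//; exact: k01.
pose lk s := dmin (clamp 0 1 (kc s)).
pose hk s := dmax (clamp 0 1 (kc s)).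
have lkc : continuous lk by move=> s; exact: cvg_comp (kcc s) (@dmin_cont (kc s)).
have hkc : continuous hk by move=> s; exact: cvg_comp (kcc s) (@dmax_cont (kc s)).
have lk0 s : lk s <= 0 by apply: dmin_le0; exact: clamp_bounds.
have hk0 s : 0 <= hk s by apply: dmax_ge0; exact: clamp_bounds.
pose v s := if 0 < kc s < 1 then clamp (lk s) (hk s) (u s / gk s) else 0.
have v_in s : lk s <= v s <= hk s.
  rewrite /v; case: ifP => _; last by rewrite lk0 hk0.
  by apply: clamp_bounds; exact: le_trans (hk0 s).
pose nu x t := if x == kc t then v t else 0.
have um : measurable_fun setT u by apply/measurable_EFinP; exact: measurable_int uint.
have vm : measurable_fun setT v.
  apply: measurable_fun_ifT.
  - apply: measurable_and; apply: measurable_fun_ltr.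
    + exact: measurable_cst.
    + exact: continuous_measurable_fun.
    + exact: continuous_measurable_fun.
    + exact: measurable_cst.
  - apply: measurable_maxr; first exact: continuous_measurable_fun.
    apply: measurable_minr; first exact: continuous_measurable_fun.
    apply: measurable_funM; first exact: um.
    apply: continuous_measurable_fun => s.
    by apply: cvgV; [rewrite gt_eqF|exact: gkc].
  - exact: measurable_cst.
have num : measurable_fun setT (fun p : R * R => nu p.1 p.2).
  apply: measurable_fun_ifT.
  - apply: measurable_fun_eqr; first exact: measurable_fst.
    apply: measurableT_comp; [exact: continuous_measurable_fun|exact: measurable_snd].
  - by apply: measurableT_comp => //; exact: measurable_snd.
  - exact: measurable_cst.
have key s : 0 < s < T ->
    (fun h => h^-1 * (kc (h + s) - kc s)) @ 0^' --> u s -> gk s * v s = u s.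
  move=> sT hu.
  have := derivative_in_bounds lo_cont hi_cont sT kcadm hu.
  rewrite /lo /hi -/(gk s) -/(lk s) -/(hk s) => /andP[h1 h2].
  rewrite /v; case: ifP => [_|/negbT].
    rewrite clamp_id; first by rewrite mulrC divfK// gt_eqF.
    by rewrite ler_pdivlMr// ler_pdivrMr// (mulrC (lk s)) (mulrC (hk s)) h1.
  rewrite mulr0 negb_and -!leNgt => /orP[ks0|ks1].
    by apply/esym; apply: (derivative_at_min _ hu) => y;
      rewrite (le_trans ks0)//; case/andP: (k01 y).
  by apply/esym; apply: (derivative_at_max _ hu) => y;
      rewrite (le_trans _ ks1)//; case/andP: (k01 y).
have [B1 B10 hB1] := @bounded_on_box R (fun x _ => dmin (clamp 0 1 x)) 0 1 0 1
  (continuous_fst_comp dmin_cont).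
have [B2 B20 hB2] := @bounded_on_box R (fun x _ => dmax (clamp 0 1 x)) 0 1 0 1
  (continuous_fst_comp dmax_cont).
have [B3 B30 hB3] := @bounded_on_box R (fun x t => g (clamp 0 1 x) t) 0 1 0 T g_cont.
have vB s : `|v s| <= B1 + B2.
  have /andP[v1 v2] := v_in s.
  have := hB1 (kc s) 0 (k01 s); have := hB2 (kc s) 0 (k01 s).
  rewrite lexx ler01 -/(lk s) -/(hk s) => /(_ isT) + /(_ isT).
  by rewrite !ler_norml => /andP[? ?] /andP[? ?]; apply/andP; split; lra.
have nuv s : nu (kc s) s = v s by rewrite /nu eqxx.
exists nu.
  split.
    move=> T' _; apply: (@box_integrable _ (fun p => nu p.1 p.2) (B1 + B2)) => //.
    by move=> p; rewrite /nu; case: ifP => // _; rewrite normr0 addr_ge0// ltW.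
  move=> x t x01 t0; rewrite /nu; case: eqP => [xk|_]; last first.
    by split; rewrite ?dmin_le0 ?dmax_ge0.
  have := v_in t; rewrite /lk /hk -xk clamp_id// => /andP[v1 v2].
  split=> // x_eq; rewrite /v -xk x_eq ?ltxx ?andbF//.
have GE : (fun s => g (k (clamp 0 T s)) s * nu (k (clamp 0 T s)) s) =
    (fun s => gk s * v s).
  by apply/funext => s; rewrite -/(kc s) nuv -gkE.
have Gm : measurable_fun setT (fun s => gk s * v s).
  by apply: measurable_funM => //; exact: continuous_measurable_fun.
split => /=; rewrite GE.
  have m1 : measurable (`[0, T]%classic : set (measurableTypeR R)) by [].
  apply: measurable_bounded_integrable => //.
  - suff : (@lebesgue_measure R `[0%R, T]%classic < +oo)%E by [].
    by rewrite lebesgue_measure_itv/=; case: ifP => _; rewrite -?EFinB ltry.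
  - exact: measurable_funS Gm.
  - exists (B3 * (B1 + B2)); split; first exact: num_real.
    move=> M hM s /=; rewrite in_itv/= => sT; apply: le_trans (ltW hM).
    by rewrite normrM ler_pM//; exact: (hB3 _ _ (k01 s) sT).
move=> t /[dup] tT /andP[t0 tT']; rewrite ku//; congr (_ + _); congr fine.
apply: ae_eq_integral => //.
- by apply/measurable_EFinP; exact: measurable_funS um.
- by apply/measurable_EFinP; exact: measurable_funS Gm.
have ae_neq (c : R) : {ae @lebesgue_measure R, forall x, x != c}.
  exists [set c]; split; [exact: measurable_set1|exact: lebesgue_measure_set1|].
  by move=> x /= /negP; rewrite negbK => /eqP.
have := @filterS3 _ _ (ae_filter_ringOfSetsType (@lebesgue_measure R)) _ _ _ _ _
  u' (ae_neq 0) (ae_neq T); apply => s hs s0 sT /=; rewrite in_itv/= => /andP[s0' st].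
have sTT : 0 < s < T by rewrite !lt_neqAle eq_sym s0 s0' sT (le_trans st).
by rewrite (key s sTT (hs sTT)).
Qed.

(** The controls disappear: the problem is to maximize an integral over the
    curves of the differential inclusion [g * dmin <= k' <= g * dmax].  Clamping
    the first argument extends the coefficients continuously to the whole
    plane. *)
Lemma attainable_curves T x : 0 <= T ->
  attainable g f (controls dmin dmax) x T =
  [set expR (path_integral F 0 T k) | k in
    [set k | inclusion_curve lo hi 0 T k /\ k T = x]].
Proof.
move=> T0; apply/seteqP; split=> [_ [nu [r [k [nuA traj kT ->]]]]|_ [k [kadm kT] <-]].
  exists k; first by split => //; exact: trajectory_inclusion_curve nuA traj.
  exact/esym/(trajectory_payoff T0 nuA traj).
have [L L0 /(_ k kadm)[kL k01]] := inclusion_curve_clamp lo_cont hi_cont T0.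
have [nu nuA kcar] := curve_control T0 kadm.
have hc := continuous_along F_cont (lipschitz_continuous kL).
pose r (t : R) := expR (\int[@lebesgue_measure R]_(s in `[-1, t])
  F (k (clamp 0 T s)) s).
have FE s : F (k (clamp 0 T s)) s = f (k (clamp 0 T s)) s.
  by rewrite /F (@clamp_id _ 0 1)//; exact: k01.
have rE t : 0 <= t -> r t = r 0 +
    \int[@lebesgue_measure R]_(s in `[0, t]) (f (k (clamp 0 T s)) s * r s).
  move=> t0; rewrite {1}/r (exp_solves_linear_ode t0 hc); congr (_ + _).
  by apply: eq_Rintegral => s _; rewrite FE.
exists nu, r, (k \o clamp 0 T); split => //.
- split => //; first exact: expR_gt0.
  + by move=> t _; split; [exact: expR_ge0|exact: k01].
  + split; last by move=> t /andP[t0 _]; exact: rE.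
    have rc : {within `[0, T], continuous r}.
      apply: derivable_within_continuous => t; rewrite in_itv/= => /andP[t0 _].
      have dP := is_derive_integral hc (lt_le_trans (ltrN10 R) t0).
      by have [] := is_derive1_comp (is_derive_expR _) dP.
    have qc : continuous (fun s => F (k (clamp 0 T s)) s * r (clamp 0 T s)).
      by move=> s; apply: cvgM; [exact: hc|exact: (clamp_within_continuous T0 rc)].
    have := continuous_integrable_segment 0 T qc.
    apply: eq_integrable; first exact: measurable_itv.
    move=> s; rewrite inE/= in_itv/= => sT.
    by rewrite /comp FE (@clamp_id _ 0 T s).
- by rewrite /= clamp_id// T0 lexx.
- rewrite /r -expRB (integral_segmentB hc (ltW (ltrN10 R)) T0); congr expR.
  by apply: eq_Rintegral => s; rewrite inE/= in_itv/= => sT; rewrite clamp_id.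
Qed.

End trajectories.

(** * Continuity of the coefficients *)

Lemma bilinear_form_continuous (R : realType) (n : nat) (u v : R -> 'cV[R]_n)
    (A B : 'M[R]_n) (w : R -> R) : continuous w ->
  (forall i, continuous (fun t => u t i 0)) ->
  (forall i, continuous (fun t => v t i 0)) ->
  continuous (fun p : R * R => ((u p.2)^T *m (A + w p.1 *: B) *m v p.2) 0 0).
Proof.
move=> wc uc vc.
have -> : (fun p : R * R => ((u p.2)^T *m (A + w p.1 *: B) *m v p.2) 0 0) =
    (fun p : R * R =>
      \sum_j (\sum_i u p.2 i 0 * (A i j + w p.1 * B i j)) * v p.2 j 0).
  apply/funext => p; rewrite !mxE; apply: eq_bigr => j _; rewrite !mxE.
  by congr (_ * _); apply: eq_bigr => i _; rewrite !mxE.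
have snd_c (d : R -> R) : continuous d -> continuous (fun p : R * R => d p.2).
  move=> dc p.
  have p2 : (fun p : R * R => p.2) @ p --> p.2 by case: p => p1 p2; exact: cvg_snd.
  exact: (@cvg_comp _ _ _ _ _ _ _ _ p2 (dc p.2)).
move=> p; apply: cvg_big => [|j _]; first exact: add_continuous.
apply: cvgM; last exact: (snd_c _ (vc j)).
apply: cvg_big => [|i _]; first exact: add_continuous.
apply: cvgM; first exact: (snd_c _ (uc i)).
apply: cvgD; first exact: cvg_cst.
by apply: cvgMr_tmp; exact: (continuous_fst_comp wc).
Qed.

Lemma ivec_continuous (R : realType) i : continuous (fun t : R => ivec t i 0).
Proof.
have -> : (fun t : R => ivec t i 0) = if i == 0 then cos else sin.
  by apply/funext => t; rewrite mxE; case: ifP.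
by case: ifP => _; [exact: continuous_cos|exact: continuous_sin].
Qed.

Lemma jvec_continuous (R : realType) i : continuous (fun t : R => jvec t i 0).
Proof.
have -> : (fun t : R => jvec t i 0) = if i == 0 then (fun t => - sin t) else cos.
  by apply/funext => t; rewrite mxE; case: ifP.
case: ifP => _ t; last exact: continuous_cos.
by apply: cvgN; exact: continuous_sin.
Qed.

Lemma gfun_clamp_continuous (R : realType) (A : 'M[R]_2) (b c : 'cV[R]_2) :
  continuous (fun p : R * R => gfun A b c (clamp 0 1 p.1) p.2).
Proof.
exact: (bilinear_form_continuous (A := A) (B := b *m c^T) (clamp_continuous ler01)
  (@jvec_continuous R) (@ivec_continuous R)).
Qed.

Lemma hfun_clamp_continuous (R : realType) (A : 'M[R]_2) (b c : 'cV[R]_2) :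
  continuous (fun p : R * R => hfun A b c (clamp 0 1 p.1) p.2).
Proof.
exact: (bilinear_form_continuous (A := A) (B := b *m c^T) (clamp_continuous ler01)
  (@ivec_continuous R) (@ivec_continuous R)).
Qed.

(** * The minimum over the controls *)

Section hamiltonian.
Context (R : realType) (dmin dmax : R -> R).
Hypothesis dmin_le0 : forall k : R, 0 <= k <= 1 -> dmin k <= 0.
Hypothesis dmax_ge0 : forall k : R, 0 <= k <= 1 -> 0 <= dmax k.

(** At a single interior point the value of a control can be prescribed freely
    within its bounds, so the infimum in the Hamiltonian is a minimum over an
    interval. *)
Lemma control_spike (k t w : R) : 0 < k < 1 -> dmin k <= w <= dmax k ->
  controls dmin dmax (fun x s => if (x == k) && (s == t) then w else 0).
Proof.
move=> /andP[k0 k1] /andP[w1 w2]; split.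
  move=> T _; apply: (@box_integrable _
    (fun p => if (p.1 == k) && (p.2 == t) then w else 0) `|w|).
    apply: measurable_fun_ifT; [|exact: measurable_cst|exact: measurable_cst].
    by apply: measurable_and; apply: measurable_fun_eqr;
      [exact: measurable_fst|exact: measurable_cst
      |exact: measurable_snd|exact: measurable_cst].
  by move=> p; case: ifP => // _; rewrite normr0.
move=> x s x01 s0; case: ifP => [/andP[/eqP -> _]|_].
  by split => // kE; move: k0 k1; rewrite kE ltxx.
by split; rewrite ?dmin_le0 ?dmax_ge0.
Qed.

Lemma hamiltonian_le (g : R -> R -> R) (phi : R * R -> R) (k t w : R) :
  0 < k < 1 -> 0 <= t -> 0 <= g k t -> dmin k <= w <= dmax k ->
  hjb_lhs g (controls dmin dmax) phi k t <=
    'D_(0, 1) phi (k, t) + g k t * w * 'D_(1, 0) phi (k, t).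
Proof.
move=> /[dup] k01 /andP[k0 k1] t0 g0 ww; rewrite /hjb_lhs lerD2l -mulrA ler_wpM2l//.
set d := 'D_(1, 0) phi (k, t).
apply: ge_inf; last first.
  exists (fun x s => if (x == k) && (s == t) then w else 0).
    exact: control_spike.
  by rewrite !eqxx.
exists (Num.min (dmin k * d) (dmax k * d)) => _ [nu [_ nuA] <-].
have [|n1 n2 _ _] := nuA k t _ t0; first by rewrite !ltW.
rewrite ge_min; have [d0|d0] := leP 0 d; first by rewrite ler_wpM2r.
by apply/orP; right; rewrite ler_nM2r.
Qed.

Lemma hamiltonian_ge (g : R -> R -> R) (phi : R * R -> R) (k t y : R) :
  0 < k < 1 -> 0 <= t -> 0 < g k t ->
  (forall w, dmin k <= w <= dmax k ->
    y <= 'D_(0, 1) phi (k, t) + g k t * w * 'D_(1, 0) phi (k, t)) ->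
  y <= hjb_lhs g (controls dmin dmax) phi k t.
Proof.
move=> /[dup] k01 /andP[k0 k1] t0 g0 hy; rewrite /hjb_lhs -lerBlDl -ler_pdivrMl//.
have k01' : 0 <= k <= 1 by rewrite !ltW.
apply: lb_le_inf.
  exists (0 * 'D_(1, 0) phi (k, t)), (fun x s => if (x == k) && (s == t) then 0 else 0).
    by apply: control_spike => //; rewrite dmin_le0// dmax_ge0.
  by rewrite !eqxx.
move=> _ [nu [_ nuA] <-].
have [n1 n2 _ _] := nuA k t k01' t0.
rewrite ler_pdivrMl// lerBlDl mulrA; apply: hy; rewrite n1 n2//.
Qed.

End hamiltonian.

(** * The theorem *)

Unset Implicit Arguments.

Theorem lemma1 (R : realType) (A : 'M[R]_2) (b c : 'cV[R]_2)
    (dmin dmax : R -> R)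
    (dmin_cont : {within `[0, 1], continuous dmin})
    (dmax_cont : {within `[0, 1], continuous dmax})
    (dmin_le0 : forall k : R, 0 <= k <= 1 -> dmin k <= 0)
    (dmax_ge0 : forall k : R, 0 <= k <= 1 -> 0 <= dmax k)
    (g_gt0 : forall k t : R, 0 <= k <= 1 -> 0 < gfun A b c k t) :
  let g := gfun A b c in
  let f := fquot A b c in
  let Adm := controls dmin dmax in
  let rho := value g f Adm in
  [/\ forall k t : R, 0 <= k <= 1 -> 0 <= t ->
        is_maximum (attainable g f Adm k t) (rho k t),
      viscosity_solution g f Adm rho &
      forall k : R, 0 <= k <= 1 -> rho k 0 = 1].
Proof.
move=> g f Adm rho.
have clamp01 (x : R) : 0 <= clamp 0 1 x <= 1 by apply: clamp_bounds.
have gc : continuous (fun p : R * R => g (clamp 0 1 p.1) p.2).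
  exact: gfun_clamp_continuous.
have fc : continuous (fun p : R * R => f (clamp 0 1 p.1) p.2).
  move=> p; apply: cvgM; first exact: hfun_clamp_continuous.
  by apply: cvgV; [rewrite gt_eqF// g_gt0|exact: gc].
have minc := clamp_within_continuous ler01 dmin_cont.
have maxc := clamp_within_continuous ler01 dmax_cont.
pose lo x s := g (clamp 0 1 x) s * dmin (clamp 0 1 x).
pose hi x s := g (clamp 0 1 x) s * dmax (clamp 0 1 x).
pose F x s := f (clamp 0 1 x) s.
have Fc : continuous (fun p : R * R => F p.1 p.2) := fc.
have loc : continuous (fun p : R * R => lo p.1 p.2) := rate_bound_continuous gc minc.
have hic : continuous (fun p : R * R => hi p.1 p.2) := rate_bound_continuous gc maxc.
have lo0 x s : lo x s <= 0 by rewrite /lo pmulr_rle0 ?dmin_le0// g_gt0.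
have hi0 x s : 0 <= hi x s by rewrite /hi pmulr_rge0 ?dmax_ge0// g_gt0.
have attE x T : 0 <= T -> attainable g f Adm x T =
    [set expR (path_integral F 0 T k) | k in
      [set k | inclusion_curve lo hi 0 T k /\ k T = x]].
  exact: attainable_curves.
have opt x T : 0 <= x <= 1 -> 0 <= T -> exists k,
    [/\ inclusion_curve lo hi 0 T k, k T = x, rho x T = expR (path_integral F 0 T k) &
      is_maximum (attainable g f Adm x T) (rho x T)].
  move=> x01 T0.
  have [k [kadm kT kmax]] := path_integral_max_exists loc hic Fc lo0 hi0 T0 x01.
  have kM : is_maximum (attainable g f Adm x T) (expR (path_integral F 0 T k)).
    rewrite attE//; split; first by exists k.
    by move=> _ [k' [k'adm k'T] <-]; rewrite ler_expR; exact: kmax.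
  have rhoE : rho x T = expR (path_integral F 0 T k).
    rewrite /rho /value; apply/le_anti/andP; split.
      by apply: ge_sup; [exists (expR (path_integral F 0 T k)); case: kM|case: kM].
    by apply: ub_le_sup; [exists (expR (path_integral F 0 T k)); case: kM|case: kM].
  by exists k; split => //; rewrite rhoE.
have att x T : 0 <= x <= 1 -> 0 <= T -> exists k, [/\ inclusion_curve lo hi 0 T k,
    k T = x & rho x T = expR (path_integral F 0 T k)].
  by move=> x01 T0; have [k [? ? ? _]] := opt x T x01 T0; exists k.
have ub T k : 0 <= T -> inclusion_curve lo hi 0 T k ->
    expR (path_integral F 0 T k) <= rho (k T) T.
  move=> T0 kadm; have kT : 0 <= k T <= 1 by apply: kadm.1; rewrite T0 lexx.
  have [_ [_ _ _ [_]]] := opt _ _ kT T0; apply; rewrite attE//.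
  by exists k.
split.
- by move=> k t k01 t0; have [_ [_ _ _ h]] := opt k t k01 t0.
- split=> phi k t phi_smooth /[dup] k01 /andP[k0 k1] t0 phiE phi_near;
    have dphi : differentiable phi (k, t) by [exact: (phi_smooth 1%N).1];
    have k01' : 0 <= k <= 1 by [rewrite !ltW];
    have gk : 0 < g k t by [exact: g_gt0].
  + apply: hamiltonian_ge => // [|w /andP[w1 w2]]; first exact: ltW.
    have := @supersolution_slope R lo hi F rho loc hic Fc lo0 hi0 att ub phi k t
      (g k t * w) dphi k01 t0 phiE phi_near.
    by rewrite /lo /hi /F clamp_id// !ler_pM2l// w1 w2 => ->.
  + have [w wE] := @subsolution_slope R lo hi F rho loc hic Fc att ub phi k t
      dphi k01 t0 phiE phi_near.
    rewrite /F clamp_id//; apply: le_trans.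
    have [w' ww' ->] : exists2 w', dmin k <= w' <= dmax k & w = g k t * w'.
      have d0 := le_trans (dmin_le0 k k01') (dmax_ge0 k k01').
      case: wE => ->; rewrite /lo /hi clamp_id//.
        by exists (dmin k) => //; rewrite lexx.
      by exists (dmax k) => //; rewrite lexx andbT.
    by apply: hamiltonian_le => //; exact: ltW.
- move=> k k01; have [_ [_ _ _ [att0 _]]] := opt k 0 k01 (lexx 0).
  have [nu [r [k' [_ [r0 _ _ _] _ ->]]]] := att0.
  by rewrite divff// gt_eqF.
Qed.
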